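(* In the setting of the context (generalized Gauss-Newton formulation), let hypotheses (B1)--(B8) of the context hold, with $c_{tc}$ in (B5) sufficiently small. Let, for each $\delta$, $\beta_k$ and $h=h_k$ be such that $\tilde{\underline\theta}\, I_{3,h}^{k}\le I_{2,h}^{k}\le \tilde{\overline\theta}\, I_{3,h}^{k}$, let $k_*=k_*(\delta)=\min\{k\in\mathbb{N} : I_{3,h}^{k}\le \tau^2\delta^2\}$, and let $(q^k_{h_k},u^k_{h_k})$ be the primal part of a KKT point of the discretized constrained problem of the context. Assume additionally the variational inequality $$|(q^\dagger-q_0,q-q^\dagger)_Q+(u^\dagger-u_0,u-u^\dagger)_V|\le c\,\sqrt{\|q-q^\dagger\|_Q^2+\|u-u^\dagger\|_V^2}\;\kappa\!\left(\frac{\|C(u)-C(u^\dagger)\|_G^2+\varrho\|A(q,u)-A(q^\dagger,u^\dagger)\|_{W^*}}{\|q-q^\dagger\|_Q^2+\|u-u^\dagger\|_V^2}\right)$$ for all $(q,u)\in\mathcal D(A)$ with $u\in\mathcal D(C)$, with $\varrho$ sufficiently large (as in the context) and independent of $q,u$, and with some $\kappa:\mathbb R^+\to\mathbb R^+$ such that $\kappa^2$ is strictly monotonically increasing on $(0,\|\mathbf F'(q^\dagger,u^\dagger)\|^2]$, $\phi$ defined by $\phi^{-1}(\lambda)=\kappa^2(\lambda)$ is convex, and $\psi$ defined by $\psi(\lambda)=\kappa(\lambda)\sqrt\lambda$ is strictly monotonically increasing on $(0,\|\mathbf F'(q^\dagger,u^\dagger)\|^2]$. Then there exist $\bar\delta>0$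 and a constant $\bar C>0$ independent of $\delta$ such that for all $\delta\in(0,\bar\delta]$ the convergence rates $$\|q_{\rm old}^{k_*}-q^\dagger\|_Q^2+\|u_{\rm old}^{k_*}-u^\dagger\|_V^2=\mathcal O\Big(\frac{\delta^2}{\psi^{-1}(\bar C\delta)}\Big)$$ are obtained, where $q_{\rm old}^{k_*}=q^{k_*-1}_{h_{k_*-1}}$ and $u_{\rm old}^{k_*}=u^{k_*-1}_{h_{k_*-1}}$ (the discrete iterates of step $k_*-1$, computed with $\beta_{k_*-1}$ and data $g^\delta$).
   Context: Setting. $Q,V,G,W$ are Hilbert spaces, $W^*$ is the dual of $W$; $(\cdot,\cdot)_Q$, $(\cdot,\cdot)_V$ are inner products. $A:\mathcal D(A)\subseteq Q\times V\to W^*$ and $C:\mathcal D(C)\subseteq V\to G$ are (generally nonlinear) operators with derivatives $A'_q,A'_u,C'$; $f\in W^*$, $g\in G$. The all-at-once system is $\mathbf F(q,u)=\mathbf g$ with $\mathbf F(q,u)=(C(u),A(q,u))\in G\times W^*$, $\mathbf g=(g,f)$. Noisy data $g^\delta\in G$ satisfy $\|g-g^\delta\|_G\le\delta$. $(q_0,u_0)\in Q\times V$ is an initial guess and $\mathcal B_\rho(q_0,u_0)$ the ball of radius $\rho$ in $Q\times V$, normed by $\|(q,u)\|_{Q\times V}^2=\|q\|_Q^2+\|u\|_V^2$. The constant $c>0$ in the variational inequality does not depend on $(q,u)$. Iteration. In step $k\ge1$, $Q,V,W$ are replaced by finite dimensional subspaces $Q_{h_k},V_{h_k},W_{h_k}$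 (possibly different for each $k$; one writes $h=h_k$). $\|\cdot\|_{W_h^*}$ denotes the dual norm with respect to $W_h$ and $\|\cdot\|_{V_{h}}$ the norm of $V_h$. The iteration starts with $(q^0_{h_0},u^0_{h_0})=(q_0,u_0)$, and $(q_{\rm old},u_{\rm old})=(q^k_{\rm old},u^k_{\rm old})=(q^{k-1}_{h_{k-1}},u^{k-1}_{h_{k-1}})$ is the previous iterate, which is not re-discretized in step $k$. With $L_{k-1}=A'_q(q_{\rm old},u_{\rm old})$, $K_{k-1}=A'_u(q_{\rm old},u_{\rm old})$ and regularization parameter $\beta_k>0$, the discretized constrained problem is $$\min_{(q,u)\in Q_{h_k}\times V_{h_k}}\|C(u_{\rm old})+C'(u_{\rm old})(u-u_{\rm old})-g^\delta\|_G^2+\tfrac1{\beta_k}\big(\|q-q_0\|_Q^2+\|u-u_0\|_{V_{h_k}}^2\big)$$ $$\text{s.t. } L_{k-1}(q-q_{\rm old})+K_{k-1}(u-u_{\rm old})+A(q_{\rm old},u_{\rm old})=f\ \text{ in }W_{h_k}^* ,$$ and $(q^k_h,u^k_h)=(q^k_{h_k},u^k_{h_k})$ is the primal part of a KKT point of it. The auxiliary continuous iterate $(q^k,u^k)$ is the solution of the same problem with $Q,V,W^*$ in place of $Q_{h_k},V_{h_k},W_{h_k}^*$ (same $(q_{\rm old},u_{\rm old})$, $\beta_k$), with Lagrange multiplier (adjoint state) $z^k\in W$; that is, $(q^k,u^k,z^k)$ is a stationary point on $Q\times V\times W$ of the Lagrangian $$\mathcal L(q,u,z)=\|C(u_{\rm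 old})+C'(u_{\rm old})(u-u_{\rm old})-g^\delta\|_G^2+\tfrac1{\beta_k}\big(\|q-q_0\|_Q^2+\|u-u_0\|_V^2\big)+\langle f-A(q_{\rm old},u_{\rm old})-L_{k-1}(q-q_{\rm old})-K_{k-1}(u-u_{\rm old}),z\rangle_{W^*,W}.$$ All iterates depend on $\delta$. Penalty parameter. $c_{\rm adj}$ denotes a constant independent of $k$ such that $\|z^k\|_W\le c_{\rm adj}(\|q_{\rm old}-q_0\|_Q+\|u_{\rm old}-u_0\|_V+1)$ whenever $(q_{\rm old},u_{\rm old})\in\mathcal B_\rho(q_0,u_0)$ and $(q^k,u^k,z^k)\in Q\times V\times W$ is a stationary point of the Lagrangian $\mathcal L$, i.e. $\mathcal L'_q(q^k,u^k,z^k)=0$, $\mathcal L'_u(q^k,u^k,z^k)=0$ and $\mathcal L'_z(q^k,u^k,z^k)=0$ (similarly for the discretized problems), and $\varrho>0$ is fixed with $\varrho\ge c_{\rm adj}(\|q^\dagger-q_0\|_Q+\|u^\dagger-u_0\|_V+1)$. Quantities of interest. Define $$I_2(u_{\rm old},u)=\|C'(u_{\rm old})(u-u_{\rm old})+C(u_{\rm old})-g^\delta\|_G^2,\qquad I_1(u_{\rm old},q,u,\beta)=I_2(u_{\rm old},u)+\tfrac1\beta(\|q-q_0\|_Q^2+\|u-u_0\|_V^2),$$ $$I_3(q_{\rm old},u_{\rm old})=\|C(u_{\rm old})-g^\delta\|_G^2+\varrho\|A(q_{\rm old},u_{\rm old})-f\|_{W^*},\qquad I_4(q,u)=\|C(u)-g^\delta\|_G^2+\varrho\|A(q,u)-f\|_{W^*},$$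 and let $I_{1,h},\dots,I_{4,h}$ be the same expressions with $\|\cdot\|_V$ replaced by $\|\cdot\|_{V_{h_k}}$ and $\|\cdot\|_{W^*}$ by $\|\cdot\|_{W_{h_k}^*}$ (so $I_{2,h}=I_2$). Set $I_1^k=I_1(u^k_{\rm old},q^k,u^k,\beta_k)$, $I_2^k=I_2(u^k_{\rm old},u^k)$, $I_3^k=I_3(q^k_{\rm old},u^k_{\rm old})$, $I_4^k=I_4(q^k,u^k)$, and $I_{1,h}^k=I_{1,h}(u^k_{\rm old},q^k_{h_k},u^k_{h_k},\beta_k)$, $I_{2,h}^k=I_{2,h}(u^k_{\rm old},u^k_{h_k})$, $I_{3,h}^k=I_{3,h}(q^k_{\rm old},u^k_{\rm old})$, $I_{4,h}^k=I_{4,h}(q^k_{h_k},u^k_{h_k})$. Hypotheses. (B1) There is a solution $(q^\dagger,u^\dagger)\in\mathcal B_\rho(q_0,u_0)\subset\mathcal D(A)\cap(Q\times\mathcal D(C))$ of $\mathbf F(q,u)=\mathbf g$. (B2) The PDE $A(q,u)=f$ (for $u$, given $q$), and especially also its linearization at $(q,u)$, is uniquely and stably solvable (in particular $A'_u(q,u):V\to W^*$ has a bounded inverse). (B3) The norms in $G$ and $Q$, the operator $C$ and the semilinear form $a(q,u)(v)=\langle A(q,u),v\rangle_{W^*,W}$ are evaluated exactly. (B4) $\mathbf F$ is continuous and weakly sequentially closed: for all sequences $(q_n,u_n)$ in $Q\times V$, if $q_n\rightharpoonup q$, $u_n\rightharpoonup u$, $C(u_n)\to g$, $A(q_n,u_n)\to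 f$, then $u\in\mathcal D(C)$, $(q,u)\in\mathcal D(A)$, $C(u)=g$ and $A(q,u)=f$. (B5) There are $0<c_{tc}<1$ and $\rho>0$ such that for all $(q,u),(\bar q,\bar u)\in\mathcal B_\rho(q_0,u_0)$ $$\|C(u)-C(\bar u)-C'(u)(u-\bar u)\|_G\le c_{tc}\|C(u)-C(\bar u)\|_G,$$ $$\|A(q,u)-A(\bar q,\bar u)-A'_q(q,u)(q-\bar q)-A'_u(q,u)(u-\bar u)\|_{W^*}\le 4c_{tc}^2\|A(q,u)-A(\bar q,\bar u)\|_{W^*}.$$ (B6) $\tau,\tilde{\underline\theta}$ are sufficiently large and $\tilde{\overline\theta}$ is sufficiently small that $$2\Big(c_{tc}^2+\frac{(1+c_{tc})^2}{\tau^2}\Big)<\tilde{\underline\theta},\qquad \frac{2\tilde{\overline\theta}+4c_{tc}^2}{1-4c_{tc}^2}<1 .$$ (B7) $|I_{i,h}^k-I_i^k|\le\eta_i^k$ for $i\in\{1,2,3,4\}$, where $$\eta_1^k+4c_{tc}^2\eta_3^k\le\Big(\tilde{\underline\theta}-2\Big(2c_{tc}^2+\frac{(1+2c_{tc})^2}{\tau^2}\Big)\Big)I_{3,h}^k,$$ $$\eta_3^k\le c_1I_{3,h}^k,\qquad \eta_2^k\to0,\ \eta_3^k\to0,\ \eta_4^k\to0\ \text{ as }k\to\infty,$$ $$I_{3,h}^k\le(1+c_3)I_{4,h}^{k-1}+r^k,\qquad (1+c_3)\frac{2\tilde{\overline\theta}+4c_{tc}^2}{1-4c_{tc}^2}\le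 c_2<1,$$ for some constants $c_1,c_2,c_3>0$ and a sequence $r^k\to0$ as $k\to\infty$. (B8) $\displaystyle\sup_{(q,u)\in\mathcal B_\rho(q_0,u_0)}\big(\|A(q,u)\|_{W^*}+\|A'_q(q,u)\|_{Q\to W^*}+\|A'_u(q,u)^*\|_{W^*\to V}+\|A'_u(q,u)^{-1}\|_{W^*\to V}\big)<\infty$ and $\displaystyle\sup_{u\in\mathcal B_\rho(u_0)}\big(\|C(u)\|_G+\|C'(u)\|_{V\to G}\big)<\infty$.
   Formalization: The discrete norm of V_h is assumed to come from an inner product and to dominate the norm of V (the norm inherited from V is included); for an arbitrary norm on V_h the discrete iterates can converge to a different solution and the rate fails. *)

(* Defs.v *)
From HB Require Import structures.
From mathcomp Require Import all_boot all_order all_algebra.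
From mathcomp Require Import all_classical all_reals all_analysis.

Set Implicit Arguments.
Unset Strict Implicit.
Unset Printing Implicit Defensive.

Import Order.TTheory GRing.Theory Num.Theory.
Import numFieldNormedType.Exports.

Local Open Scope classical_set_scope.
Local Open Scope ring_scope.

HB.mixin Record isHilbert (R : realType) H & CompleteNormedModule R H := {
  hdot : H -> H -> R ;
  hdotC : forall x y, hdot x y = hdot y x ;
  hdotDl : forall x y z, hdot (x + y) z = hdot x z + hdot y z ;
  hdotZl : forall (a : R) x y, hdot (a *: x) y = a * hdot x y ;
  hdot_norm : forall x, hdot x x = `|x| ^+ 2
}.

#[short(type="hilbertType")]
HB.structure Definition Hilbert (R : realType) :=
  { H of isHilbert R H & CompleteNormedModule R H }.

Definition bounded_linear_op (R : realType) (E F : normedModType R) :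
  {pred E -> F} := [pred f : E -> F | `[< linear f /\ continuous f >]].

Section BoundedOp.
Variables (R : realType) (E F : normedModType R).

Record bop := Bop {
  bop_fun :> E -> F ;
  _ : bop_fun \in @bounded_linear_op R E F }.

HB.instance Definition _ := [isSub for bop_fun].
HB.instance Definition _ := [Choice of bop by <:].

Lemma bounded_linear_op_submod : submod_closed (@bounded_linear_op R E F).
Proof.
split=> [|a f g].
  apply/asboolP; split=> [a x y|]; first by rewrite scaler0 addr0.
  exact: cst_continuous.
move=> /asboolP[lf cf] /asboolP[lg cg]; apply/asboolP; split=> [b x y|].
  have fgE z : (a *: f + g) z = a *: f z + g z by [].
  rewrite !fgE lf lg !scalerDr !scalerA (mulrC a b).
  by rewrite -!addrA; congr (_ + _); rewrite addrCA.
move=> x; apply: (@continuousD _ _ _ (a \*: f) g); last exact: cg.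
by apply: continuousZl_tmp; exact: cf.
Qed.

HB.instance Definition _ := GRing.isSubmodClosed.Build R (E -> F)
  (@bounded_linear_op R E F) bounded_linear_op_submod.
HB.instance Definition _ := [SubChoice_isSubLmodule of bop by <:].

Lemma bop_linear (f : bop) : linear f.
Proof. by case: f => f /= /asboolP[]. Qed.

HB.instance Definition _ (f : bop) :=
  GRing.isLinear.Build R E F _ (bop_fun f) (@bop_linear f).

Lemma bop_continuous (f : bop) : continuous f.
Proof. by case: f => f /= /asboolP[]. Qed.

End BoundedOp.

Section OperatorNorm.
Variables (R : realType) (E F : normedModType R).

(* For a subspace [S], the operator norm of [f] restricted to [S]; with
   [F := R^o] and [S := W_h] it is the norm of W_h^*.  The supremum is finite
   for bounded [f]; [sup] returns 0 on unbounded sets. *)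
Definition opnorm_on (S : set E) (f : E -> F) : R :=
  sup [set `|f x| | x in [set x | S x /\ `|x| <= 1]].

Lemma bop_bounded (f : bop E F) : exists2 M : R, 0 < M & forall x, `|f x| <= M * `|x|.
Proof.
have /linear_bounded_continuous/linear_boundedP := @bop_continuous _ _ _ f.
by move=> /pinfty_ex_gt0[M M0 fM]; exists M.
Qed.

Lemma opnorm_onP (S : set E) (f : bop E F) (x : E) :
  S x -> `|x| <= 1 -> `|f x| <= opnorm_on S f.
Proof.
move=> Sx x1; apply: ub_le_sup; last by exists x.
have [M M0 fM] := bop_bounded f; exists M => _ [y [_ y1] <-].
by rewrite (le_trans (fM y))// ler_piMr// ltW.
Qed.

Lemma opnorm_le (f : bop E F) (M : R) :
  (forall x, `|x| <= 1 -> `|f x| <= M) -> opnorm_on setT f <= M.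
Proof.
move=> fM; apply: ge_sup; last by move=> _ [y [_ y1] <-]; exact: fM.
by exists `|f 0|, 0 => //; split => //; rewrite normr0.
Qed.

Let opnormD (f g : bop E F) :
  opnorm_on setT (f + g) <= opnorm_on setT f + opnorm_on setT g.
Proof.
apply: opnorm_le => x x1; rewrite (le_trans (ler_normD _ _))//.
by apply: lerD; exact: opnorm_onP.
Qed.

Let opnormZ_le (a : R) (f : bop E F) :
  opnorm_on setT (a *: f) <= `|a| * opnorm_on setT f.
Proof.
apply: opnorm_le => x x1.
rewrite (_ : (a *: f) x = a *: f x)// normrZ ler_wpM2l//.
exact: opnorm_onP.
Qed.

Let opnormZ (a : R) (f : bop E F) :
  opnorm_on setT (a *: f) = `|a| * opnorm_on setT f.
Proof.
apply/eqP; rewrite eq_le opnormZ_le/=; have [->|a0] := eqVneq a 0.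
  rewrite normr0 mul0r; have := @opnorm_onP setT (0 *: f) 0 I.
  by rewrite normr0 ler01 => /(_ isT); exact: le_trans.
rewrite -ler_pdivlMl ?normr_gt0// -normfV.
by rewrite -[in leLHS](scalerK a0 f) opnormZ_le.
Qed.

Let opnorm0_eq0 (f : bop E F) : opnorm_on setT f = 0 -> f = 0.
Proof.
move=> f0; apply/val_inj/funext => x /=.
have [->|x0] := eqVneq x 0; first by rewrite linear0.
apply/eqP; rewrite -normr_eq0 eq_le normr_ge0 andbT.
have : `|f (`|x|^-1 *: x)| <= 0.
  rewrite -f0 opnorm_onP// normrZ normfV normr_id mulVf ?normr_eq0//.
by rewrite linearZ/= normrZ pmulr_rle0// normr_gt0 invr_eq0 normr_eq0.
Qed.

HB.instance Definition _ :=
  Lmodule_isNormed.Build R (bop E F) opnormD opnormZ opnorm0_eq0.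

End OperatorNorm.

Notation "''B' ( E , F )" := (bop E F) (at level 8, format "''B' ( E ,  F )").

Definition dual (R : realType) (E : normedModType R) := 'B(E, R^o).

Definition dual_dot (R : realType) (E : normedModType R) (f g : dual E) : R :=
  (`|f + g| ^+ 2 - `|f - g| ^+ 2) / 4.

(* Hilbert space adjoint; the inner product of E^* is recovered from its norm by
   polarization. *)
Definition is_adjoint (R : realType) (H E : hilbertType R)
    (T : 'B(H, dual E)) (Ts : 'B(dual E, H)) :=
  forall (f : dual E) (x : H), hdot (Ts f) x = dual_dot f (T x).

Definition is_inverse (R : realType) (E F : normedModType R)
    (T : 'B(E, F)) (Ti : 'B(F, E)) := cancel T Ti /\ cancel Ti T.

(* Frechet derivative relative to [D]; at interior points of [D] it is the usual
   one. *)
Definition is_frechet_within (R : realType) (E F : normedModType R)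
    (D : set E) (f : E -> F) (x : E) (T : E -> F) :=
  forall e : R, 0 < e ->
    \forall y \near within D (nbhs x),
      `|f y - f x - T (y - x)| <= e * `|y - x|.

Definition weakly_cvg (R : realType) (E : normedModType R)
    (x_ : nat -> E) (x : E) :=
  forall l : dual E, (fun n => l (x_ n)) @ \oo --> l x.

Definition fin_dim_subspace (R : realType) (E : lmodType R) (S : set E) :=
  exists (n : nat) (b : 'I_n -> E),
    S = [set x | exists a : 'I_n -> R, x = \sum_(i < n) a i *: b i].

(* ||(q, u)||^2 in the Hilbert product (the library norm on products is the
   equivalent maximum norm). *)
Definition sqnorm (R : realType) (E F : normedModType R) (x : E) (y : F) : R :=
  `|x| ^+ 2 + `|y| ^+ 2.

(* An inner product to be used with the discretization V_h of V; it is defined on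
   all of V because it is applied to [u - u0] with [u] in V_h and [u0] in V.  The
   norm inherited from V is the case of equality in the last condition, which
   rules out discrete norms that would not control the iterates in V. *)
Definition discrete_inner_product (R : realType) (V : hilbertType R)
    (d : V -> V -> R) :=
  [/\ forall x y, d x y = d y x,
      forall x y z, d (x + y) z = d x z + d y z,
      forall (a : R) x y, d (a *: x) y = a * d x y &
      forall x, `|x| ^+ 2 <= d x x].

(* The operators are total functions; only their values on the domains matter.
   [dAq], [dAu], [dC] are meant to be the derivatives, see [has_derivatives]. *)
Record problem (R : realType) (Q V G W : hilbertType R) := Problem {
  domA : set (Q * V) ;
  domC : set V ;
  opA : Q -> V -> dual W ;
  opC : V -> G ;
  dAq : Q -> V -> 'B(Q, dual W) ;
  dAu : Q -> V -> 'B(V, dual W) ;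
  dC : V -> 'B(V, G) ;
  rhs : dual W ;
  obs : G ;
  q0 : Q ;
  u0 : V
}.

(* [Qh k], [Vh k], [Wh k], [dotVh k] (the inner product of V_h), [beta k] and
   the continuous iterate [(qc k, uc k, zc k)] belong to step [k >= 1];
   [(qh k, uh k)] is the discrete iterate of step [k], and [(qh 0, uh 0)] the
   starting point.  [eta1] to [eta4] and [rest] are the error bounds of
   [discretization_accuracy]. *)
Record gn_run (R : realType) (Q V W : hilbertType R) := GNRun {
  Qh : nat -> set Q ;
  Vh : nat -> set V ;
  Wh : nat -> set W ;
  dotVh : nat -> V -> V -> R ;
  beta : nat -> R ;
  qh : nat -> Q ;
  uh : nat -> V ;
  qc : nat -> Q ;
  uc : nat -> V ;
  zc : nat -> W ;
  eta1 : nat -> R ;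
  eta2 : nat -> R ;
  eta3 : nat -> R ;
  eta4 : nat -> R ;
  rest : nat -> R
}.

Section GaussNewton.
Variables (R : realType) (Q V G W : hilbertType R).
Variable P : problem Q V G W.

Local Notation A := (opA P).
Local Notation C := (opC P).
Local Notation f := (rhs P).
Local Notation g := (obs P).
Local Notation q0 := (q0 P).
Local Notation u0 := (u0 P).

Definition in_ball (rho : R) (q : Q) (u : V) :=
  Num.sqrt (sqnorm (q - q0) (u - u0)) <= rho.

Definition domF : set (Q * V) := domA P `&` [set x | domC P x.2].

Definition opF (x : Q * V) : G * dual W := (C x.2, A x.1 x.2).

(* Operator norm of F'(q, u) between the Hilbert products Q x V and G x W^*. *)
Definition dFnorm (q : Q) (u : V) : R :=
  sup [set Num.sqrt (sqnorm (dC P u d.2) (dAq P q u d.1 + dAu P q u d.2))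
      | d in [set d : Q * V | Num.sqrt (sqnorm d.1 d.2) <= 1]].

Definition has_derivatives (rho : R) :=
  (forall q u, in_ball rho q u ->
    is_frechet_within (domA P) (fun x => A x.1 x.2) (q, u)
      (fun d => dAq P q u d.1 + dAu P q u d.2)) /\
  (forall u, `|u - u0| <= rho -> is_frechet_within (domC P) C u (dC P u)).

Definition is_solution_in_ball (rho : R) (qd : Q) (ud : V) :=
  [/\ in_ball rho qd ud,
      forall q u, in_ball rho q u -> domF (q, u),
      C ud = g &
      A qd ud = f].

Definition pde_solvable (rho : R) :=
  (forall q, `|q - q0| <= rho ->
    exists u, [/\ domA P (q, u), A q u = f,
      forall u', domA P (q, u') -> A q u' = f -> u' = u &
      forall e : R, 0 < e -> exists2 d : R, 0 < d &
        forall u', domA P (q, u') -> `|A q u' - f| <= d -> `|u' - u| <= e]) /\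
  (forall q u, in_ball rho q u -> exists Ti, is_inverse (dAu P q u) Ti).

Definition weakly_seq_closed :=
  {within domF, continuous opF} /\
  (forall (q_ : nat -> Q) (u_ : nat -> V) (q : Q) (u : V),
    (forall n, domF (q_ n, u_ n)) ->
    weakly_cvg q_ q -> weakly_cvg u_ u ->
    (fun n => C (u_ n)) @ \oo --> g ->
    (fun n => A (q_ n) (u_ n)) @ \oo --> f ->
    [/\ domC P u, domA P (q, u), C u = g & A q u = f]).

Definition tangential_cone (rho ctc : R) :=
  forall q u q' u', in_ball rho q u -> in_ball rho q' u' ->
    `|C u - C u' - dC P u (u - u')| <= ctc * `|C u - C u'| /\
    `|A q u - A q' u' - dAq P q u (q - q') - dAu P q u (u - u')|
      <= 4 * ctc ^+ 2 * `|A q u - A q' u'|.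

Definition bounded_on_ball (rho : R) :=
  (exists M : R, forall q u, in_ball rho q u ->
    exists (Ts Ti : 'B(dual W, V)),
      [/\ is_adjoint (dAu P q u) Ts, is_inverse (dAu P q u) Ti &
          `|A q u| + `|dAq P q u| + `|Ts| + `|Ti| <= M]) /\
  (exists M : R, forall u, `|u - u0| <= rho -> `|C u| + `|dC P u| <= M).

Section Data.
Variable gd : G.

Definition I2 (uo u : V) : R := `|dC P uo (u - uo) + C uo - gd| ^+ 2.

(* [d] is the inner product giving the norm of [u - u0]: that of V for I_1, that
   of V_h for I_{1,h} and the discretized problem. *)
Definition I1 (d : V -> V -> R) (uo : V) (q : Q) (u : V) (b : R) : R :=
  I2 uo u + b^-1 * (`|q - q0| ^+ 2 + d (u - u0) (u - u0)).

(* I_3 and I_4 are given by the same expression at different arguments;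
   [S := setT] yields the norm of W^* and [S := W_h] that of W_h^*. *)
Definition I34 (varrho : R) (S : set W) (q : Q) (u : V) : R :=
  `|C u - gd| ^+ 2 + varrho * opnorm_on S (A q u - f).

Definition Lagrangian (d : V -> V -> R)
    (b : R) (qo : Q) (uo : V) (q : Q) (u : V) (z : W) : R :=
  `|C uo + dC P uo (u - uo) - gd| ^+ 2
  + b^-1 * (`|q - q0| ^+ 2 + d (u - u0) (u - u0))
  + (f - A qo uo - dAq P qo uo (q - qo) - dAu P qo uo (u - uo)) z.

(* Stationary points of the Lagrangian on SQ x SV x SW: the vanishing of L'_z is
   the linearized state equation in the dual of SW. *)
Definition stationary (SQ : set Q) (SV : set V) (SW : set W)
    (d : V -> V -> R) (b : R) (qo : Q) (uo : V) (q : Q) (u : V) (z : W) :=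
  [/\ [/\ SQ q, SV u & SW z],
      forall dq, SQ dq ->
        is_derive q dq (fun q' => Lagrangian d b qo uo q' u z : R^o) 0,
      forall du, SV du ->
        is_derive u du (fun u' => Lagrangian d b qo uo q u' z : R^o) 0 &
      forall dz, SW dz ->
        is_derive z dz (fun z' => Lagrangian d b qo uo q u z' : R^o) 0].

Section Run.
Variable X : gn_run Q V W.

Definition qold (k : nat) : Q := qh X k.-1.
Definition uold (k : nat) : V := uh X k.-1.

Definition gn_iteration :=
  [/\ qh X 0 = q0, uh X 0 = u0 &
    forall k, (0 < k)%N ->
      [/\ [/\ fin_dim_subspace (Qh X k), fin_dim_subspace (Vh X k),
              fin_dim_subspace (Wh X k) & discrete_inner_product (dotVh X k)],
          0 < beta X k,
          exists zh, stationary (Qh X k) (Vh X k) (Wh X k) (dotVh X k)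
            (beta X k) (qold k) (uold k) (qh X k) (uh X k) zh &
          stationary setT setT setT (@hdot R V)
            (beta X k) (qold k) (uold k) (qc X k) (uc X k) (zc X k)]].

Definition adjoint_bound (rho cadj : R) :=
  forall k, (0 < k)%N -> in_ball rho (qold k) (uold k) ->
    forall q u z,
      stationary setT setT setT (@hdot R V)
        (beta X k) (qold k) (uold k) q u z \/
      stationary (Qh X k) (Vh X k) (Wh X k) (dotVh X k)
        (beta X k) (qold k) (uold k) q u z ->
    `|z| <= cadj * (`|qold k - q0| + `|uold k - u0| + 1).

Definition I1k (k : nat) := I1 (@hdot R V) (uold k) (qc X k) (uc X k) (beta X k).
Definition I2k (k : nat) := I2 (uold k) (uc X k).
Definition I3k (varrho : R) (k : nat) := I34 varrho setT (qold k) (uold k).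
Definition I4k (varrho : R) (k : nat) := I34 varrho setT (qc X k) (uc X k).

Definition I1hk (k : nat) := I1 (dotVh X k) (uold k) (qh X k) (uh X k) (beta X k).
Definition I2hk (k : nat) := I2 (uold k) (uh X k).
Definition I3hk (varrho : R) (k : nat) := I34 varrho (Wh X k) (qold k) (uold k).
Definition I4hk (varrho : R) (k : nat) := I34 varrho (Wh X k) (qh X k) (uh X k).

(* I_{4,h}^{k-1} is only available for k >= 2, as W_{h_k} is introduced in
   step k >= 1. *)
Definition discretization_accuracy
    (varrho ctc tau theta_lo theta_hi c1 c2 c3 : R) :=
  [/\ forall k, (0 < k)%N ->
        [/\ `|I1hk k - I1k k| <= eta1 X k,
            `|I2hk k - I2k k| <= eta2 X k,
            `|I3hk varrho k - I3k varrho k| <= eta3 X k &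
            `|I4hk varrho k - I4k varrho k| <= eta4 X k],
      forall k, (0 < k)%N ->
        eta1 X k + 4 * ctc ^+ 2 * eta3 X k <=
          (theta_lo - 2 * (2 * ctc ^+ 2 + (1 + 2 * ctc) ^+ 2 / tau ^+ 2))
          * I3hk varrho k /\
        eta3 X k <= c1 * I3hk varrho k,
      [/\ eta2 X @ \oo --> 0, eta3 X @ \oo --> 0, eta4 X @ \oo --> 0
        & rest X @ \oo --> 0],
      forall k, (1 < k)%N ->
        I3hk varrho k <= (1 + c3) * I4hk varrho k.-1 + rest X k &
      (1 + c3) * ((2 * theta_hi + 4 * ctc ^+ 2) / (1 - 4 * ctc ^+ 2)) <= c2
      /\ c2 < 1].

Definition beta_choice (varrho theta_lo theta_hi : R) :=
  forall k, (0 < k)%N ->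
    theta_lo * I3hk varrho k <= I2hk k <= theta_hi * I3hk varrho k.

Definition is_stopping_index (varrho tau delta : R) (k : nat) :=
  [/\ (0 < k)%N, I3hk varrho k <= tau ^+ 2 * delta ^+ 2 &
      forall j, (0 < j < k)%N -> tau ^+ 2 * delta ^+ 2 < I3hk varrho j].

End Run.
End Data.

(* For (q, u) = (qd, ud) both sides vanish, whatever [0 / 0] is. *)
Definition variational_inequality (qd : Q) (ud : V) (varrho c : R)
    (kappa : R -> R) :=
  forall q u, domA P (q, u) -> domC P u ->
    `|hdot (qd - q0) (q - qd) + hdot (ud - u0) (u - ud)| <=
      c * Num.sqrt (sqnorm (q - qd) (u - ud)) *
      kappa ((`|C u - C ud| ^+ 2 + varrho * `|A q u - A qd ud|)
             / sqnorm (q - qd) (u - ud)).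

End GaussNewton.

Definition parameter_choice (R : realType) (ctc tau theta_lo theta_hi : R) :=
  2 * (ctc ^+ 2 + (1 + ctc) ^+ 2 / tau ^+ 2) < theta_lo /\
  (2 * theta_hi + 4 * ctc ^+ 2) / (1 - 4 * ctc ^+ 2) < 1.

(* The inverse of [h] restricted to [D], defined on the image of [D]. *)
Definition inv_on (R : realType) (D : set R) (h : R -> R) : R -> R :=
  'pinv_(fun=> 0) D h.

Definition psi (R : realType) (kappa : R -> R) (x : R) : R :=
  kappa x * Num.sqrt x.

(* Here D = (0, ||F'||^2].  The inverse of [kappa ^ 2] is a function on the image
   of D; that it is convex includes that its domain is an interval. *)
Definition index_function (R : realType) (D : set R) (kappa : R -> R) :=
  let kappa2 := fun x => kappa x ^+ 2 in
  [/\ forall x, 0 <= x -> 0 <= kappa x,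
      {in D &, {homo kappa2 : x y / x < y}},
      is_interval (kappa2 @` D) /\
      convex_function (E := R^o) (kappa2 @` D) (inv_on D kappa2) &
      {in D &, {homo psi kappa : x y / x < y}}].

(* Main.v *)
Require Import Defs.
From HB Require Import structures.
From mathcomp Require Import all_boot all_order all_algebra.
From mathcomp Require Import all_classical all_reals all_analysis.
From mathcomp Require Import ring lra.

Set Implicit Arguments.
Unset Strict Implicit.
Unset Printing Implicit Defensive.

Import Order.TTheory GRing.Theory Num.Theory.
Import numFieldNormedType.Exports.

Local Open Scope classical_set_scope.
Local Open Scope ring_scope.

(* The continuous iterate minimizes, for its multiplier, the convex quadratic
   Lagrangian.  Comparison with the value at the exact solution xd, where the
   tangential cone condition makes the linearized residuals small, shows that as
   long as [tau ^+ 2 * delta ^+ 2 < I_3h] the regularization term of the discrete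
   iterate does not exceed the one of xd; hence the iterates stay in the ball.
   Unless it stops, I_3h is then contracted by the factor c2 up to a vanishing
   perturbation, so the stopping index exists.

   There, with x the stopped iterate and e = |x - xd|, one has
   e^2 <= 2 |(xd - x0, x - xd)|, while the misfit of x in the variational
   inequality is at most b^2 delta^2.  Let mu = psi^-1 (b delta / (2 c)).  If
   b^2 delta^2 < mu e^2, the variational inequality gives e <= 2 c kappa(mu), so
   b delta < sqrt(mu) e <= 2 c psi(mu) = b delta, a contradiction. *)

(** * Stationary points of the Lagrangian *)

(** The difference quotient is [a + h * b] for [h != 0]. The Lagrangian has this form along every
    line, so stationarity becomes the vanishing of a linear coefficient, without differentiating
    norms or pairings. *)
Lemma quadratic_derive0 (R : realType) (E : normedModType R) (F : E -> R^o)
    (x v : E) (a b : R) :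
  (forall h : R, F (h *: v + x) = F x + h * a + h ^+ 2 * b) ->
  is_derive x v F 0 -> a = 0.
Proof.
move=> Fq dF; rewrite -(@derive_val _ _ _ _ _ _ _ dF) /derive.
apply/esym/cvg_lim => //.
apply: (@cvg_trans _ ((fun h : R => a + h * b) @ 0^')).
  apply: near_eq_cvg; near=> h.
  have h0 : h != 0 by near: h; exact: nbhs_dnbhs_neq.
  by rewrite /= Fq /GRing.scale/=; field.
have a0 : a + 0 * b = a by rewrite mul0r addr0.
apply: (@cvg_trans _ (nbhs (a + 0 * b))); last by rewrite a0.
apply: cvg_within_filter; apply: cvgD; first exact: cvg_cst.
by apply: cvgM; [exact: cvg_id|exact: cvg_cst].
Unshelve. all: by end_near. Qed.

Section Hilbert.
Variables (R : realType) (H : hilbertType R).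
Implicit Types x y z : H.

Lemma hdotDr x y z : hdot x (y + z) = hdot x y + hdot x z.
Proof. by rewrite hdotC hdotDl !(hdotC x). Qed.

Lemma hdotZr (a : R) x y : hdot x (a *: y) = a * hdot x y.
Proof. by rewrite hdotC hdotZl hdotC. Qed.

Lemma sqr_normD x y : `|x + y| ^+ 2 = `|x| ^+ 2 + 2 * hdot x y + `|y| ^+ 2.
Proof. by rewrite -!hdot_norm hdotDl !hdotDr (hdotC y x); ring. Qed.

Lemma sqr_normDZ (h : R) x y :
  `|x + h *: y| ^+ 2 = `|x| ^+ 2 + h * (2 * hdot x y) + h ^+ 2 * `|y| ^+ 2.
Proof. by rewrite sqr_normD hdotZr normrZ exprMn real_normK ?num_real//; ring. Qed.

End Hilbert.

Lemma dual_linearP (R : realType) (E : normedModType R) (l : dual E) (h : R)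
  (x y : E) : l (h *: x + y) = h * l x + l y :> R.
Proof. exact: linearP. Qed.

Lemma dual_scaleDE (R : realType) (E : normedModType R) (k l : dual E)
  (h : R) (x : E) : (h *: k + l) x = h * k x + l x :> R.
Proof. by []. Qed.

Lemma subr_scaleD (R : realType) (E : lmodType R) (h : R) (x y z : E) :
  x - (h *: y + z) = - h *: y + (x - z).
Proof. by rewrite opprD addrCA scaleNr. Qed.

Section Stationary.
Variables (R : realType) (Q V G W : hilbertType R).
Variables (P : problem Q V G W) (gd : G).

Lemma stationary_state_eq (b : R) (qo : Q) (uo : V) q u z :
  stationary P gd setT setT setT (@hdot R V) b qo uo q u z ->
  rhs P - opA P qo uo - dAq P qo uo (q - qo) - dAu P qo uo (u - uo) = 0.
Proof.
case=> _ _ _ dz; apply/val_inj/funext => w /=.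
(* The Lagrangian is affine in the multiplier: the quadratic coefficient is 0 and the linear one is
   the state residual applied to [w]. *)
apply: (@quadratic_derive0 _ _ _ z w _ 0 _ (dz w I)) => h.
rewrite /Lagrangian; set F := (rhs P - _ - _ - _).
by rewrite dual_linearP; ring.
Qed.

(** The expansion about a stationary point has no linear part and a nonnegative quadratic part. At
    the stationary point itself the state equation removes the multiplier term, so the Lagrangian
    equals [I1] there. *)
Lemma stationary_Lagrangian_ge (b : R) (qo : Q) (uo : V) q u z q' u' :
  0 < b ->
  stationary P gd setT setT setT (@hdot R V) b qo uo q u z ->
  I1 P gd (@hdot R V) uo q u b
    <= Lagrangian P gd (@hdot R V) b qo uo q' u' z.
Proof.
move=> b0 st; have state := stationary_state_eq st.
case: st => _ dq du _.
have dotE (H : hilbertType R) h (x y : H) : hdot (h *: y + x) (h *: y + x) =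
    hdot x x + h * (2 * hdot x y) + h ^+ 2 * hdot y y.
  by rewrite !hdot_norm addrC sqr_normDZ.
have Lq h v : Lagrangian P gd (@hdot R V) b qo uo (h *: v + q) u z =
    Lagrangian P gd (@hdot R V) b qo uo q u z
    + h * (b^-1 * (2 * hdot (q - q0 P) v) - dAq P qo uo v z)
    + h ^+ 2 * (b^-1 * `|v| ^+ 2).
  rewrite /Lagrangian -!(addrA (h *: v)) -!hdot_norm.
  rewrite linearP subr_scaleD -[_ + _ - dAu P qo uo _]addrA dual_scaleDE dotE.
  by rewrite !hdot_norm; ring.
(* There is no mixed term in [q] and [u], so the linear coefficient does not depend on [q1].
   Stationarity at [q] therefore also removes it at [q'], and the two arguments can be moved one
   after the other. *)
have Lu h v q1 : Lagrangian P gd (@hdot R V) b qo uo q1 (h *: v + u) z =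
    Lagrangian P gd (@hdot R V) b qo uo q1 u z
    + h * (2 * hdot (opC P uo + dC P uo (u - uo) - gd) (dC P uo v)
           + b^-1 * (2 * hdot (u - u0 P) v) - dAu P qo uo v z)
    + h ^+ 2 * (`|dC P uo v| ^+ 2 + b^-1 * `|v| ^+ 2).
  rewrite /Lagrangian -!(addrA (h *: v)) dotE -hdot_norm
    (linearP (dC P uo)) (linearP (dAu P qo uo)).
  have -> : opC P uo + (h *: dC P uo v + dC P uo (u - uo)) - gd =
     h *: dC P uo v + (opC P uo + dC P uo (u - uo) - gd).
    by rewrite addrCA -!addrA.
  rewrite dotE.
  rewrite subr_scaleD dual_scaleDE.
  rewrite !hdot_norm; ring.
have q'E : q' = 1 *: (q' - q) + q by rewrite scale1r subrK.
have u'E : u' = 1 *: (u' - u) + u by rewrite scale1r subrK.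
rewrite u'E Lu q'E Lq.
rewrite (quadratic_derive0 (fun h => Lq h (q' - q)) (dq _ I)).
have du0 := quadratic_derive0 (fun h => Lu h (u' - u) q) (du _ I).
rewrite du0 /Lagrangian state /I1 /I2.
rewrite (addrC (dC P uo (u - uo))) expr1n !mulr0 !mul1r !addr0.
rewrite -[leRHS]addrA lerDl.
by rewrite !addr_ge0// ?mulr_ge0// ?invr_ge0 ?ltW// exprn_ge0.
Qed.

End Stationary.

(** * Comparison of one step with the exact solution *)

Lemma bop_norm_le (R : realType) (E F : normedModType R) (l : 'B(E, F)) x :
  `|l x| <= `|l| * `|x|.
Proof.
have [->|x0] := eqVneq x 0; first by rewrite linear0 !normr0 mulr0.
have := @opnorm_onP _ _ _ setT l (`|x|^-1 *: x) I.
rewrite linearZ !normrZ normfV normr_id mulVf ?normr_eq0// => /(_ (lexx _)).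
by rewrite mulrC ler_pdivrMr ?normr_gt0.
Qed.

Lemma sqr_le_sumD (R : realFieldType) (x a b : R) :
  0 <= x -> x <= a + b -> x ^+ 2 <= 2 * a ^+ 2 + 2 * b ^+ 2.
Proof.
move=> x0 xab; apply: (@le_trans _ _ ((a + b) ^+ 2)).
  by rewrite ler_pXn2r ?nnegrE// (le_trans x0).
have := sqr_ge0 (a - b).
nra.
Qed.

Lemma sqnorm_ge0 (R : realType) (E F : normedModType R) (x : E) (y : F) :
  0 <= sqnorm x y.
Proof. by rewrite addr_ge0// exprn_ge0. Qed.

(** Passes from the Euclidean norm, in which the iterates are controlled, to the sum of norms
    occurring in the adjoint bound. *)
Lemma addr_le_double (R : realType) (E F : normedModType R)
    (x x' : E) (y y' : F) :
  sqnorm x y <= sqnorm x' y' -> `|x| + `|y| <= 2 * (`|x'| + `|y'|).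
Proof.
rewrite /sqnorm => le.
rewrite -(@ler_pXn2r _ 2) ?nnegrE ?addr_ge0 ?mulr_ge0 ?addr_ge0//.
move: (normr_ge0 x') (normr_ge0 y') le; move: `|x| `|y| `|x'| `|y'|.
move=> a b a' b' a0 b0 le.
have := sqr_ge0 (a - b); have := mulr_ge0 a0 b0.
have := sqr_ge0 a'; have := sqr_ge0 b'.
nra.
Qed.

Section GaussNewtonStep.
Variables (R : realType) (Q V G W : hilbertType R).
Variables (P : problem Q V G W) (rho ctc varrho cadj delta : R).
Variables (gd : G) (qd : Q) (ud : V).
Hypothesis ctc_gt0 : 0 < ctc.
Hypothesis tcone : tangential_cone P rho ctc.
Hypothesis ball_d : in_ball P rho qd ud.
Hypothesis C_d : opC P ud = obs P.
Hypothesis A_d : opA P qd ud = rhs P.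
Hypothesis noise : `|obs P - gd| <= delta.
Hypothesis cadj_le : cadj * (`|qd - q0 P| + `|ud - u0 P| + 1) <= varrho.

(** The linearization error is a multiple [ctc] of the distance to the exact data. The noise enters
    twice: once directly, and once with factor [ctc] when that distance is replaced by the one to
    [gd]. *)
Lemma linearized_data_misfit_le q u : in_ball P rho q u ->
  `|opC P u + dC P u (ud - u) - gd|
    <= ctc * `|opC P u - gd| + (1 + ctc) * delta.
Proof.
move=> /tcone/(_ ball_d)[+ _]; rewrite C_d => tc.
have -> : opC P u + dC P u (ud - u) - gd =
    (opC P u - obs P - dC P u (u - ud)) + (obs P - gd).
  by rewrite -(opprB u ud) linearN addrA; congr (_ - _); rewrite addrAC subrK.
have gu : `|opC P u - obs P| <= `|opC P u - gd| + delta.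
  by rewrite (le_trans (ler_distD gd _ _))// lerD2l distrC.
apply: le_trans (ler_normD _ _) _.
have : ctc * `|opC P u - obs P| <= ctc * (`|opC P u - gd| + delta).
  by rewrite ler_wpM2l// ltW.
move: tc; move: `|_ - _ - _| `|obs P - gd| noise `|_ - obs P| `|_ - gd| => *.
lra.
Qed.

Lemma linearized_state_misfit_le q u : in_ball P rho q u ->
  `|rhs P - opA P q u - dAq P q u (qd - q) - dAu P q u (ud - u)|
    <= 4 * ctc ^+ 2 * `|opA P q u - rhs P|.
Proof.
move=> /tcone/(_ ball_d)[_]; rewrite A_d; apply: le_trans.
rewrite -normrN -(opprB qd q) -(opprB ud u) !linearN !opprK !opprD !opprK.
by rewrite (addrC (- rhs P)).
Qed.

Lemma multiplier_le q u (z : W) :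
  sqnorm (q - q0 P) (u - u0 P) <= sqnorm (qd - q0 P) (ud - u0 P) ->
  `|z| <= cadj * (`|q - q0 P| + `|u - u0 P| + 1) -> `|z| <= 2 * varrho.
Proof.
move=> /addr_le_double le2 zle.
have : 0 <= `|q - q0 P| + `|u - u0 P| by rewrite addr_ge0.
have := normr_ge0 z; move: le2 zle cadj_le.
move: (`|q - q0 P| + _) (`|qd - q0 P| + _) `|z| => a b c le2 zle le c0 a0.
(* The sign of [cadj] follows from its bounding a norm by a multiple of [a + 1 > 0]. *)
have cadj0 : 0 <= cadj.
  by rewrite -(@pmulr_lge0 _ (a + 1)); [exact: le_trans zle|lra].
have : cadj * (a + 1) <= cadj * (2 * (b + 1)) by rewrite ler_wpM2l//; lra.
lra.
Qed.

(* The exact solution is not feasible for the linearized state equation, so the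
   comparison is made for the Lagrangian instead of the objective. *)
Lemma stationary_I1_le (b : R) q u qk uk z : 0 < b ->
  in_ball P rho q u ->
  sqnorm (q - q0 P) (u - u0 P) <= sqnorm (qd - q0 P) (ud - u0 P) ->
  stationary P gd setT setT setT (@hdot R V) b q u qk uk z ->
  `|z| <= cadj * (`|q - q0 P| + `|u - u0 P| + 1) ->
  I1 P gd (@hdot R V) u qk uk b <=
    8 * ctc ^+ 2 * I34 P gd varrho setT q u + 2 * (1 + ctc) ^+ 2 * delta ^+ 2
    + b^-1 * sqnorm (qd - q0 P) (ud - u0 P).
Proof.
move=> b0 ball le_d st /(multiplier_le le_d) zle.
apply: le_trans (stationary_Lagrangian_ge qd ud b0 st) _.
rewrite /Lagrangian hdot_norm -/(sqnorm _ _) addrAC lerD2r.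
have := linearized_state_misfit_le ball.
set F := (rhs P - _ - _ - _) => Fle.
have Fz : F z <= 8 * ctc ^+ 2 * (varrho * `|opA P q u - rhs P|).
  apply: le_trans (ler_norm _) _; apply: le_trans (bop_norm_le _ _) _.
  rewrite [leRHS](_ : _ = (4 * ctc ^+ 2 * `|opA P q u - rhs P|) * (2 * varrho)).
    exact: ler_pM.
  by ring.
(* Squaring gives the factor [2 * ctc ^+ 2]; it is enlarged to the factor of the state term, so that
   both terms combine to [I34]. *)
have : `|opC P u + dC P u (ud - u) - gd| ^+ 2 <=
    8 * ctc ^+ 2 * `|opC P u - gd| ^+ 2 + 2 * (1 + ctc) ^+ 2 * delta ^+ 2.
  have le := linearized_data_misfit_le ball.
  move: (sqr_le_sumD (normr_ge0 _) le) (sqr_ge0 (ctc * `|opC P u - gd|)).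
  rewrite !exprMn; move: (`|_| ^+ 2) (`|opC P u - gd| ^+ 2) => x a.
  move: (ctc ^+ 2) ((1 + ctc) ^+ 2) (delta ^+ 2) => *.
  lra.
move: Fz; rewrite /I34 -/(`|opA P q u - rhs P|) mulrDr.
move: (`|_ - gd| ^+ 2) (F z) (8 * ctc ^+ 2 * (varrho * _)) => x y w yw.
move: (8 * _ * _) (2 * _ * _) => *.
lra.
Qed.

End GaussNewtonStep.

(** * Contraction of the misfit *)

(** Above the level [m] the contraction lowers the sequence by at least [(1 - c) * m], and
    eventually the perturbation undoes less than half of this. The resulting linear decrease cannot
    go on forever. *)
Lemma contraction_vanishing_perturbation (R : realType) (a e : nat -> R)
    (c m : R) :
  c < 1 -> 0 < m -> e @ \oo --> 0 ->
  (\forall k \near \oo, a k.+1 <= c * a k + e k) ->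
  ~ (forall k, (0 < k)%N -> m < a k).
Proof.
move=> c1 m0 e0 rec am.
have m2 : 0 < (1 - c) * m / 2 by rewrite divr_gt0// mulr_gt0// subr_gt0.
have /cvgrPdist_lt/(_ _ m2) e_small := e0.
have [K _ HK] : \forall k \near \oo, a k.+1 <= a k - (1 - c) * m / 2.
  near=> k.
  have ek : `|0 - e k| < (1 - c) * m / 2 by near: k.
  have rk : a k.+1 <= c * a k + e k by near: k.
  have mk : m < a k by apply: am; near: k; exact: nbhs_infty_gt.
  move: ek; rewrite sub0r normrN => /ltr_normlW; nra.
(* Starting at [K.+1] keeps the indices positive, where the lower bound [m] is available. *)
have dec n : a (K.+1 + n)%N <= a K.+1 - ((1 - c) * m / 2) *+ n.
  elim: n => [|n IH]; first by rewrite addn0 mulr0n subr0.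
  rewrite addnS mulrSr opprD addrA (le_trans (HK _ _)) ?lerD2r//=.
  by rewrite addSnnS leq_addr.
move: (archi_boundP (normr_ge0 (a K.+1 / ((1 - c) * m / 2)))) => /ltr_normlW.
set n := Num.bound _; rewrite ltr_pdivrMr// mulr_natl => Hn.
by have := lt_le_trans (am (K.+1 + n)%N isT) (dec n); rewrite ltNge; lra.
Unshelve. all: by end_near. Qed.

Lemma le_absorb (R : realFieldType) (c x x' y y' w : R) : 0 < 1 - c ->
  x' <= w + c * (x + x') -> y' <= c * (y + y') ->
  x' + y' <= (w + c * (x + y)) / (1 - c).
Proof. by move=> c1 xle yle; rewrite ler_pdivlMr//; nra. Qed.

Lemma inverse_gap_gt0 (R : realFieldType) (c : R) :
  0 < c -> c <= 4^-1 -> 0 < 1 - 4 * c ^+ 2.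
Proof. by move=> c0 c4; have := ler_pM2l c0 c 4^-1; rewrite c4; nra. Qed.

Section StepMisfit.
Variables (R : realType) (Q V G W : hilbertType R).
Variables (P : problem Q V G W) (rho ctc varrho : R) (gd : G).
Hypothesis ctc_gt0 : 0 < ctc.
Hypothesis tcone : tangential_cone P rho ctc.
Hypothesis varrho_gt0 : 0 < varrho.

(** By the linearized state equation the new state residual is a pure linearization error; the new
    data residual is one plus the residual squared in [I2]. The cone condition bounds these errors
    partly by the new residuals, and that part is absorbed on the left, whence the denominator. *)
Lemma stationary_I4_le (b : R) q u qk uk z : ctc <= 4^-1 ->
  in_ball P rho q u -> in_ball P rho qk uk ->
  stationary P gd setT setT setT (@hdot R V) b q u qk uk z ->
  I34 P gd varrho setT qk uk <=
    (2 * I2 P gd u uk + 4 * ctc ^+ 2 * I34 P gd varrho setT q u)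
      / (1 - 4 * ctc ^+ 2).
Proof.
move=> ctc4 ball ballk st; have [tcC tcA] := tcone ball ballk.
have den := inverse_gap_gt0 ctc_gt0 ctc4.
have c2_ge0 : 0 <= 4 * ctc ^+ 2 by rewrite mulr_ge0// exprn_ge0// ltW.
have stateE : opA P qk uk - rhs P =
    - (opA P q u - opA P qk uk - dAq P q u (q - qk) - dAu P q u (u - uk)).
  have /eqP := stationary_state_eq st; rewrite !subr_eq add0r => /eqP ->.
  rewrite -(opprB qk q) -(opprB uk u) !linearN !opprK !opprD !addrA opprK.
  by rewrite [LHS](ACl (1 * 4 * 3 * 2))/= (addrC (opA P qk uk)).
have Ale : `|opA P qk uk - rhs P| <=
    4 * ctc ^+ 2 * (`|opA P q u - rhs P| + `|opA P qk uk - rhs P|).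
  rewrite {1}stateE normrN (le_trans tcA)// ler_wpM2l//.
  by rewrite (distrC (opA P qk uk)) ler_distD.
have Cle : `|opC P uk - gd| <= `|dC P u (uk - u) + opC P u - gd| +
    ctc * (`|opC P u - gd| + `|opC P uk - gd|).
  have CE : opC P uk - gd = (dC P u (uk - u) + opC P u - gd) -
      (opC P u - opC P uk - dC P u (u - uk)).
    rewrite -(opprB uk u) linearN opprK.
    rewrite !opprD opprK !addrA [RHS](ACl ((1 * 6) * (2 * 4) * 5 * 3))/=.
    by rewrite !subrr !add0r.
  rewrite {1}CE (le_trans (ler_normB _ _))// lerD2l (le_trans tcC)//.
  by rewrite (distrC (opC P uk) gd) ler_wpM2l ?ler_distD ?(ltW ctc_gt0).
have C2le : `|opC P uk - gd| ^+ 2 <= 2 * `|dC P u (uk - u) + opC P u - gd| ^+ 2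
    + 4 * ctc ^+ 2 * (`|opC P u - gd| ^+ 2 + `|opC P uk - gd| ^+ 2).
  have := sqr_le_sumD (normr_ge0 _) Cle.
  move/le_trans; apply; rewrite lerD2l exprMn.
  have := @sqr_le_sumD _ _ (`|opC P u - gd|) (`|opC P uk - gd|) _ (lexx _).
  rewrite addr_ge0// -mulrDr => /(_ isT) le.
  rewrite [leRHS](_ : _ = 2 * (ctc ^+ 2 * (2 * (`|opC P u - gd| ^+ 2
    + `|opC P uk - gd| ^+ 2)))); last by ring.
  by rewrite !ler_wpM2l// exprn_ge0// ltW.
have := ler_wpM2l (ltW varrho_gt0) Ale; rewrite mulrCA (mulrDr varrho).
by rewrite /I34 /I2; exact: le_absorb.
Qed.

End StepMisfit.

(** * Boundedness of the iterates and termination *)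

(* [2 * ctc * s * j] is the part of the slack between [(1 + 2 * ctc) ^+ 2] and
   [(1 + ctc) ^+ 2] that is left for absorbing the error of I_2. *)
Lemma I1_absorb (R : realFieldType) (ctc s c1 th j j' d e1 e3 i b : R) :
  0 < ctc -> 0 < s -> 4 * ctc * (1 + c1) <= s -> 0 < j -> d <= s * j ->
  j' <= j + e3 -> e3 <= c1 * j ->
  e1 + 4 * ctc ^+ 2 * e3 <= (th - 2 * (2 * ctc ^+ 2 + (1 + 2 * ctc) ^+ 2 * s)) * j ->
  i <= 8 * ctc ^+ 2 * j' + 2 * (1 + ctc) ^+ 2 * d + b ->
  i + e1 + 2 * ctc * s * j <= th * j + b.
Proof.
rewrite -![_ * _ <= s]subr_ge0 -![d <= _]subr_ge0 -![j' <= _]subr_ge0.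
rewrite -![e3 <= _]subr_ge0.
rewrite -![_ <= _ * j]subr_ge0 -![i <= _]subr_ge0 -[_ <= _ * j + b]subr_ge0.
move=> c0 s0 cs j0 dj j'j e3j e1j ij.
set x := _ - _ in cs; set y := _ - _ in dj; set z := _ - _ in j'j.
set w := _ - _ in e3j; set u := _ - _ in e1j; set v := _ - _ in ij.
(* The gap is written as a nonnegative combination of the gaps in the hypotheses. The excess
   [4 * ctc ^+ 2 * (j + e3)] of the misfit term is at most [ctc * s * j], because
   [4 * ctc * (1 + c1) <= s]. *)
have -> : th * j + b - (i + e1 + 2 * ctc * s * j) =
    u + v + 8 * (ctc ^+ 2 * z) + 4 * (ctc ^+ 2 * w) + 2 * ((1 + ctc) ^+ 2 * y)
    + ctc * j * x + 6 * (ctc ^+ 2 * j * s) + ctc * s * j.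
  rewrite /x /y /z /w /u /v; ring.
clearbody x y z w u v; have d0 : 0 <= 1 + ctc by rewrite addr_ge0 ?ltW.
by rewrite !addr_ge0 ?mulr_ge0 ?exprn_ge0 // ltW.
Qed.

(** Chains the estimates of one step: the next discrete I_3 is bounded by the discrete I_4, this by
    the continuous I_4, then by the continuous I_2 and I_3, and finally by the current discrete I_3.
    The discretization errors are collected apart. *)
Lemma perturbed_contraction (R : realFieldType)
    (m c th a j j' r i2 i3 i4 i4' e2 e3 e4 : R) :
  0 <= m -> 0 <= c -> 0 < 1 - c -> 0 <= j -> m * ((2 * th + c) / (1 - c)) <= a ->
  i2 <= th * j + e2 -> i3 <= j + e3 -> i4' <= i4 + e4 ->
  i4 <= (2 * i2 + c * i3) / (1 - c) -> j' <= m * i4' + r ->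
  j' <= a * j + (m * ((2 * e2 + c * e3) / (1 - c) + e4) + r).
Proof.
move=> m0 c0 c1 j0 ma i2le i3le i4'le i4le j'le.
apply: le_trans j'le _; rewrite addrA lerD2r.
apply: (@le_trans _ _
    (m * ((2 * (th * j + e2) + c * (j + e3)) / (1 - c) + e4))).
  rewrite ler_wpM2l// (le_trans i4'le)// lerD2r (le_trans i4le)//.
  by rewrite ler_pM2r ?invr_gt0// lerD// ler_wpM2l.
rewrite [leLHS](_ : _ = m * ((2 * th + c) / (1 - c)) * j
  + m * ((2 * e2 + c * e3) / (1 - c) + e4)); last by ring.
by rewrite lerD2r ler_wpM2r.
Qed.

Section GaussNewtonRun.
Variables (R : realType) (Q V G W : hilbertType R).
Variables (P : problem Q V G W) (rho ctc varrho cadj delta : R).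
Variables (gd : G) (qd : Q) (ud : V) (X : gn_run Q V W).
Variables (tau theta_lo theta_hi c1 c2 c3 : R).
Hypothesis tau_gt0 : 0 < tau.
Hypothesis c3_gt0 : 0 < c3.
Hypothesis ctc_gt0 : 0 < ctc.
Hypothesis ctc_le4V : ctc <= 4^-1.
Hypothesis ctc_slack : 4 * ctc * (1 + c1) <= (tau ^+ 2)^-1.
Hypothesis sol : is_solution_in_ball P rho qd ud.
Hypothesis tcone : tangential_cone P rho ctc.
Hypothesis varrho_gt0 : 0 < varrho.
Hypothesis cadj_le : cadj * (`|qd - q0 P| + `|ud - u0 P| + 1) <= varrho.
Hypothesis delta_gt0 : 0 < delta.
Hypothesis noise : `|obs P - gd| <= delta.
Hypothesis iter : gn_iteration P gd X.
Hypothesis adj : adjoint_bound P gd X rho cadj.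
Hypothesis acc : discretization_accuracy P gd X varrho ctc tau
  theta_lo theta_hi c1 c2 c3.
Hypothesis beta_ok : beta_choice P gd X varrho theta_lo theta_hi.

Local Notation dist_d := (sqnorm (qd - q0 P) (ud - u0 P)).
Local Notation I3h := (I3hk P gd X varrho).

Lemma sqnorm_in_ball q u :
  sqnorm (q - q0 P) (u - u0 P) <= dist_d -> in_ball P rho q u.
Proof.
case: sol => + _ _ _; rewrite /in_ball => ball le.
by apply: le_trans ball; exact: ler_wsqrtr.
Qed.

(** Before stopping, [delta ^+ 2] is below [I3h k / tau ^+ 2], so the noise term is paid for by
    [I3h k]. The surplus on the left is kept for [continuous_step]. *)
Lemma continuous_step_I1_le k : (0 < k)%N ->
  sqnorm (qold X k - q0 P) (uold X k - u0 P) <= dist_d ->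
  tau ^+ 2 * delta ^+ 2 < I3h k ->
  I1k P gd X k + eta1 X k + 2 * ctc * (tau ^+ 2)^-1 * I3h k
    <= theta_lo * I3h k + (beta X k)^-1 * dist_d.
Proof.
move=> k0 le_d lt_I3; have ball := sqnorm_in_ball le_d.
case: sol => ball_d _ C_d A_d.
case: iter => _ _ /(_ k k0)[_ b0 _ st].
case: acc => /(_ k k0)[_ _ I3e _] /(_ k k0)[e1e e3e] _ _ _.
have t2 : 0 < tau ^+ 2 by rewrite exprn_gt0.
have zle := adj k0 ball (or_introl st).
have := stationary_I1_le ctc_gt0 tcone ball_d C_d A_d noise cadj_le
  b0 ball le_d st zle.
apply: (@I1_absorb _ ctc _ c1 _ _ _ _ _ (eta3 X k)) => //.
- by rewrite invr_gt0.
- by apply: le_lt_trans lt_I3; rewrite mulr_ge0 ?exprn_ge0 ?ltW.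
- by rewrite mulrC ler_pdivlMr// mulrC ltW.
- by move: I3e; rewrite distrC => /ler_normlW; rewrite lerBlDl.
Qed.

(** The choice of [beta] gives the discrete I_2 at least the share [theta_lo * I3h k] of the bound
    on the discrete I_1; what is left bounds the regularization term. *)
Lemma discrete_step k : (0 < k)%N ->
  sqnorm (qold X k - q0 P) (uold X k - u0 P) <= dist_d ->
  tau ^+ 2 * delta ^+ 2 < I3h k ->
  sqnorm (qh X k - q0 P) (uh X k - u0 P) <= dist_d.
Proof.
move=> k0 le_d lt_I3; have main := continuous_step_I1_le k0 le_d lt_I3.
case: iter => _ _ /(_ k k0)[[_ _ _ [_ _ _ dge]] b0 _ _].
case: acc => /(_ k k0)[I1e _ _ _] _ _ _ _.
have /andP[lo _] := beta_ok k0.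
have I3_gt0 : 0 < I3h k.
  by apply: le_lt_trans lt_I3; rewrite mulr_ge0 ?exprn_ge0 ?ltW.
have slack : 0 <= 2 * ctc * (tau ^+ 2)^-1 * I3h k.
  by rewrite !mulr_ge0 ?invr_ge0 ?exprn_ge0 // ltW.
(* The norm of the discretization dominates that of [V]. *)
apply: le_trans (_ : `|qh X k - q0 P| ^+ 2 +
  dotVh X k (uh X k - u0 P) (uh X k - u0 P) <= _); first by rewrite lerD2l.
have b0V : 0 < (beta X k)^-1 by rewrite invr_gt0.
rewrite -(ler_pM2l b0V).
move: I1e => /ler_normlW; rewrite /I1hk /I1 -/(I2hk P gd X k).
move: lo main slack.
move: (I1k P gd X k) (I2hk P gd X k) (theta_lo * _) (2 * _ * _ * _) => a b c d.
move: ((beta X k)^-1 * (_ + _)) ((beta X k)^-1 * dist_d) (eta1 X k) => *.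
lra.
Qed.

(** The continuous iterate must lie in the ball for the cone condition to apply to it. The lower
    bound on I_2 now costs [eta2], which the surplus covers once [eta2] is small compared with
    [delta ^+ 2]. *)
Lemma continuous_step k : (0 < k)%N ->
  sqnorm (qold X k - q0 P) (uold X k - u0 P) <= dist_d ->
  tau ^+ 2 * delta ^+ 2 < I3h k ->
  eta2 X k <= 2 * ctc * delta ^+ 2 ->
  sqnorm (qc X k - q0 P) (uc X k - u0 P) <= dist_d.
Proof.
move=> k0 le_d lt_I3 e2; have main := continuous_step_I1_le k0 le_d lt_I3.
case: iter => _ _ /(_ k k0)[_ b0 _ _].
case: acc => /(_ k k0)[I1e I2e _ _] _ _ _ _.
have /andP[lo _] := beta_ok k0.
have e2' : eta2 X k <= 2 * ctc * (tau ^+ 2)^-1 * I3h k.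
  apply: le_trans e2 _; rewrite -[leRHS]mulrA ler_wpM2l ?mulr_ge0 ?(ltW ctc_gt0)//.
  by rewrite mulrC ler_pdivlMr ?exprn_gt0// mulrC ltW.
have e1 : 0 <= eta1 X k by apply: le_trans I1e.
have b0V : 0 < (beta X k)^-1 by rewrite invr_gt0.
rewrite -(ler_pM2l b0V).
move: I2e => /ler_normlW; move: main.
rewrite /I1k /I1 hdot_norm -/(sqnorm _ _) -/(I2k P gd X k).
move: lo e2' e1.
move: (I2k P gd X k) (I2hk P gd X k) (theta_lo * _) (2 * _ * _ * _) => a b c d.
move: ((beta X k)^-1 * sqnorm (qc _ _ - _) _) ((beta X k)^-1 * dist_d).
move: (eta1 X k) (eta2 X k) => *.
lra.
Qed.

(** Only the indices before [k] have to be above the stopping level, so that the stopped iterate is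
    covered. *)
Lemma qold_uold_in_ball k : (0 < k)%N ->
  (forall j, (0 < j < k)%N -> tau ^+ 2 * delta ^+ 2 < I3h j) ->
  sqnorm (qold X k - q0 P) (uold X k - u0 P) <= dist_d.
Proof.
elim: k => // -[|k] IH _ lt_I3.
  case: iter => qh0 uh0 _; rewrite /qold /uold /= qh0 uh0 !subrr.
  by rewrite {1}/sqnorm !normr0 expr0n/= ?addr0 sqnorm_ge0.
apply: discrete_step => //; last by apply: lt_I3; rewrite ltnSn.
by apply: IH => // j /andP[j0 jk]; apply: lt_I3; rewrite j0 (ltn_trans jk).
Qed.

Definition I3h_perturbation k :=
  (1 + c3) * ((2 * eta2 X k + 4 * ctc ^+ 2 * eta3 X k) / (1 - 4 * ctc ^+ 2)
    + eta4 X k) + rest X k.+1.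

Lemma I3h_contraction k : (0 < k)%N ->
  sqnorm (qold X k - q0 P) (uold X k - u0 P) <= dist_d ->
  tau ^+ 2 * delta ^+ 2 < I3h k ->
  eta2 X k <= 2 * ctc * delta ^+ 2 ->
  I3h k.+1 <= c2 * I3h k + I3h_perturbation k.
Proof.
move=> k0 le_d lt_I3 e2.
have le_c := continuous_step k0 le_d lt_I3 e2.
case: iter => _ _ /(_ k k0)[_ b0 _ st].
have := stationary_I4_le ctc_gt0 tcone varrho_gt0 ctc_le4V
  (sqnorm_in_ball le_d) (sqnorm_in_ball le_c) st.
rewrite -/(I2k P gd X k) -/(I3k P gd X varrho k) -/(I4k P gd X varrho k) => I4le.
case: acc => /(_ k k0)[_ I2e I3e I4e] _ _ /(_ k.+1 k0) rec [hi _].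
have /andP[_ I2hi] := beta_ok k0.
have I3_gt0 : 0 < I3h k.
  by apply: le_lt_trans lt_I3; rewrite mulr_ge0 ?exprn_ge0 ?ltW.
have m0 : 0 <= 1 + c3 by rewrite addr_ge0 ?(ltW c3_gt0).
have den := inverse_gap_gt0 ctc_gt0 ctc_le4V.
have I2_le : I2k P gd X k <= theta_hi * I3h k + eta2 X k.
  move: I2e; rewrite distrC => /ler_normlW; rewrite lerBlDl => /le_trans.
  by apply; rewrite lerD2r.
have I3_le : I3k P gd X varrho k <= I3h k + eta3 X k.
  by move: I3e; rewrite distrC => /ler_normlW; rewrite lerBlDl.
have I4_le : I4hk P gd X varrho k <= I4k P gd X varrho k + eta4 X k.
  by move: I4e => /ler_normlW; rewrite lerBlDl.
exact: (perturbed_contraction m0 (mulr_ge0 _ (sqr_ge0 ctc)) den (ltW I3_gt0) hi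
  I2_le I3_le I4_le I4le rec).
Qed.

Lemma I3h_perturbation_cvg0 : I3h_perturbation @ \oo --> 0.
Proof.
case: acc => _ _ [e2 e3 e4 r0] _ _.
have -> : 0 = (1 + c3) * ((2 * 0 + 4 * ctc ^+ 2 * 0) / (1 - 4 * ctc ^+ 2) + 0)
    + 0 :> R by ring.
have mulc (a l : R) (v : nat -> R) :
    v @ \oo --> l -> a * v n @[n --> \oo] --> a * l.
  by move=> vl; apply: cvgM => //; exact: cvg_cst.
apply: cvgD; last by rewrite (cvg_shiftS (rest X)).
apply: (mulc (1 + c3)); apply: cvgD => //; apply: cvgM; last exact: cvg_cst.
by apply: cvgD; exact: mulc.
Qed.

(** Without stopping, I_3h would stay above [tau ^+ 2 * delta ^+ 2] and yet be contracted up to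
    vanishing errors for all large [k]. *)
Lemma exists_stopping_index :
  c2 < 1 -> exists k, is_stopping_index P gd X varrho tau delta k.
Proof.
move=> c2_lt1.
have m0 : 0 < tau ^+ 2 * delta ^+ 2 by rewrite mulr_gt0 ?exprn_gt0.
have stops : exists k, (0 < k)%N && (I3h k <= tau ^+ 2 * delta ^+ 2).
  apply: contrapT => noP.
  have lt_I3 k : (0 < k)%N -> tau ^+ 2 * delta ^+ 2 < I3h k.
    move=> k0; rewrite ltNge; apply/negP => le.
    by apply: noP; exists k; rewrite k0.
  apply: (contraction_vanishing_perturbation c2_lt1 m0 I3h_perturbation_cvg0 _
    lt_I3).
  case: acc => _ _ [e2_0 _ _ _] _ _.
  have d2 : 0 < 2 * ctc * delta ^+ 2 by rewrite !mulr_gt0 ?exprn_gt0.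
  have /cvgrPdist_lt/(_ _ d2) e2_small := e2_0.
  near=> k.
  have k0 : (0 < k)%N by near: k; exact: nbhs_infty_gt.
  have e2 : eta2 X k <= 2 * ctc * delta ^+ 2.
    have : `|0 - eta2 X k| < 2 * ctc * delta ^+ 2 by near: k.
    by rewrite sub0r normrN => /ltr_normlW/ltW.
  apply: I3h_contraction => //; last exact: lt_I3.
  by apply: qold_uold_in_ball => // j /andP[j0 _]; exact: lt_I3.
case: (ex_minnP stops) => m /andP[m_gt0 mle] mmin.
exists m; split => // j /andP[j0 jm]; rewrite ltNge; apply/negP => le.
by move: (mmin j); rewrite j0 le leqNgt jm => /(_ isT).
Unshelve. all: by end_near. Qed.

End GaussNewtonRun.

(** * The index function and the variational inequality *)

Section IndexFunction.
Variables (R : realType) (M : R) (kappa : R -> R).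
Local Notation D := (`]0, M]%classic).
Hypothesis M_gt0 : 0 < M.
Hypothesis kappa_index : index_function D kappa.

Lemma index_function_le x y : D x -> D y -> x <= y -> kappa x <= kappa y.
Proof.
case: kappa_index => k0 kinc _ _ Dx Dy; rewrite le_eqVlt => /predU1P[->//|xy].
have x0 : 0 <= x by move: Dx; rewrite /= in_itv/= => /andP[/ltW].
have y0 : 0 <= y by move: Dy; rewrite /= in_itv/= => /andP[/ltW].
rewrite -(@ler_pXn2r _ 2) ?nnegrE ?k0//.
by apply: ltW; apply: kinc; rewrite ?inE.
Qed.

(** Nonnegativity at [x / 2] and strict monotonicity give positivity at [x]. *)
Lemma psi_gt0 x : D x -> 0 < psi kappa x.
Proof.
case: kappa_index => k0 _ _ pinc Dx.
have /andP[x0 xM] : 0 < x <= M by move: Dx; rewrite /= in_itv.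
have Dx2 : D (x / 2).
  rewrite /= in_itv/= divr_gt0//= (le_trans _ xM)// ler_pdivrMr//.
  by rewrite ler_peMr ?ler1n// ltW.
apply: le_lt_trans (_ : psi kappa (x / 2) < _).
  by rewrite mulr_ge0 ?sqrtr_ge0// k0// ltW// divr_gt0.
by apply: pinc; rewrite ?inE// ltr_pdivrMr// ltr_pMr// ltr1n.
Qed.

(** A strictly increasing function whose range has no gaps is continuous; for [kappa ^ 2] the range
    is the domain of the convex function [phi], hence an interval. *)
Lemma psi_continuous a : 0 < a -> a <= M -> {within `[a, M], continuous (psi kappa)}.
Proof.
move=> a0 aM; case: kappa_index => k0 kinc [kitv _] _.
have sub x : `[a, M]%classic x -> D x.
  by rewrite /= !in_itv/= => /andP[ax ->]; rewrite (lt_le_trans a0 ax).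
pose k2 x := kappa x ^+ 2.
have k2cont : {within `[a, M], continuous k2}.
  apply: segment_inc_surj_continuous.
    apply: le_mono_in => x y xa ya xy; apply: kinc => //; rewrite inE; exact: sub.
  move=> y /=; rewrite in_itv/= => /andP[ya yM].
  have Da : D a by apply: sub; rewrite /= in_itv/= lexx.
  have DM : D M by apply: sub; rewrite /= in_itv/= lexx aM.
  have [x Dx xy] : (k2 @` D) y.
    apply: (kitv (k2 a) (k2 M)); [by exists a|by exists M|by rewrite ya yM].
  exists x => //; rewrite /= in_itv/= leNgt; apply/andP; split; last first.
    by move: Dx; rewrite /= in_itv/= => /andP[].
  apply/negP => xa; have := kinc x a; rewrite !inE => /(_ Dx Da xa).
  by rewrite -/(k2 x) -/(k2 a) xy ltNge ya.
apply: (@subspace_eq_continuous _ _ _ (fun x => Num.sqrt (k2 x * x))).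
  move=> x; rewrite inE /= in_itv/= => /andP[ax _].
  have x0 : 0 <= x by rewrite (le_trans _ ax)// ltW.
  by rewrite sqrtrM ?sqr_ge0// sqrtr_sqr ger0_norm// k0.
move=> x; apply: continuous_comp; last exact: sqrt_continuous.
apply: cvgM; first exact: k2cont.
by apply: (continuous_subspaceT (f := fun x : R => x)) => z; exact: cvg_id.
Qed.

Lemma psi_surj y : 0 < y <= psi kappa M -> (psi kappa @` D) y.
Proof.
move=> /andP[y0 yM]; case: (kappa_index) => k0 _ _ _.
have DM : D M by rewrite /= in_itv/= M_gt0 lexx.
have kM1 : 0 < kappa M + 1 by rewrite ltr_wpDl// k0// ltW.
(* The left end for the intermediate value theorem: [kappa a <= kappa M] and
   [Num.sqrt a <= y / (kappa M + 1)] make [psi kappa a] at most [y]; adding 1 keeps the denominator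
   positive. *)
pose a := Num.min M ((y / (kappa M + 1)) ^+ 2).
have a0 : 0 < a by rewrite lt_min M_gt0 exprn_gt0// divr_gt0.
have aM : a <= M by rewrite ge_min lexx.
have Da : D a by rewrite /= in_itv/= a0 aM.
have ya : psi kappa a <= y.
  apply: (@le_trans _ _ (kappa M * (y / (kappa M + 1)))).
    rewrite /psi ler_pM ?sqrtr_ge0 ?k0 ?(ltW a0)//.
      exact: index_function_le.
    have y1 : 0 <= y / (kappa M + 1) by rewrite ltW ?divr_gt0.
    by rewrite -(ger0_norm y1) -sqrtr_sqr ler_wsqrtr// ge_min lexx orbT.
  rewrite mulrCA ler_piMr ?(ltW y0)// ler_pdivrMr// mul1r.
  by rewrite lerDl.
have [x xa <-] : exists2 x, x \in `[a, M] & psi kappa x = y.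
  apply: IVT => //; first exact: psi_continuous.
  by rewrite ge_min le_max ya yM orbT.
exists x => //; move: xa; rewrite /= !in_itv/= => /andP[ax ->].
by rewrite (lt_le_trans a0).
Qed.

Lemma inv_on_psi y : 0 < y <= psi kappa M ->
  D (inv_on D (psi kappa) y) /\ psi kappa (inv_on D (psi kappa) y) = y.
Proof.
case: kappa_index => _ _ _ pinc /psi_surj yD; split; last first.
  by apply: pinvK; rewrite inE.
rewrite /inv_on -[X in X _](@injpinv_image _ _ (fun=> 0) D (psi kappa)).
  by exists y.
by apply: inc_inj_in; apply: le_mono_in.
Qed.

End IndexFunction.

Lemma normr_le_tcone (R : realType) (E : normedModType R) (c : R) (x y : E) :
  c < 1 -> `|x - y| <= c * `|x| -> `|x| <= `|y| / (1 - c).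
Proof.
move=> c1 xy; rewrite ler_pdivlMr ?subr_gt0// mulrBr mulr1 lerBlDr.
rewrite -[x in `|x| <= _](subrK y) (le_trans (ler_normD _ _))// addrC lerD2l.
by rewrite mulrC.
Qed.

(** The two sides differ by [t * (1 - t) * sqnorm d e]. This makes the ball convex. *)
Lemma sqnorm_convex (R : realType) (E F : hilbertType R)
    (x d : E) (y e : F) (t : R) :
  0 <= t <= 1 ->
  sqnorm (x + t *: d) (y + t *: e)
    <= (1 - t) * sqnorm x y + t * sqnorm (x + d) (y + e).
Proof.
move=> /andP[t0 t1]; rewrite /sqnorm !sqr_normDZ !sqr_normD.
have h : 0 <= t * (1 - t) by rewrite mulr_ge0// subr_ge0.
have h1 := mulr_ge0 h (sqr_ge0 `|d|); have h2 := mulr_ge0 h (sqr_ge0 `|e|).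
move: (`|x| ^+ 2) (`|d| ^+ 2) (`|y| ^+ 2) (`|e| ^+ 2) (hdot x d) (hdot y e) h1 h2.
move=> a b c d' p q h1 h2; clear h t0 t1.
rewrite -subr_ge0 [leRHS](_ : _ = t * (1 - t) * b + t * (1 - t) * d'); last by ring.
exact: addr_ge0.
Qed.

Lemma quadratic_cvg_at_right0 (R : realType) (x a b : R) :
  (x + t * a + t ^+ 2 * b) @[t --> 0^'+] --> x.
Proof.
apply: (@cvg_trans _ (nbhs (x + 0 * a + 0 ^+ 2 * b))); last first.
  by rewrite expr0n/= !mul0r !addr0.
apply: cvg_at_right_filter; apply: cvgD; first apply: cvgD.
- exact: cvg_cst.
- by apply: cvgM; [exact: cvg_id|exact: cvg_cst].
- by apply: cvgM; [exact: exprn_continuous|exact: cvg_cst].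
Qed.

Section VariationalInequality.
Variables (R : realType) (Q V G W : hilbertType R).
Variables (P : problem Q V G W) (rho ctc varrho c : R).
Variables (qd : Q) (ud : V) (kappa : R -> R).
Local Notation M := (dFnorm P qd ud ^+ 2).
Local Notation D := (`]0, M]%classic).
Hypothesis rho_gt0 : 0 < rho.
Hypothesis ctc_gt0 : 0 < ctc.
Hypothesis ctc_le4V : ctc <= 4^-1.
Hypothesis sol : is_solution_in_ball P rho qd ud.
Hypothesis tcone : tangential_cone P rho ctc.
Hypothesis varrho_gt0 : 0 < varrho.
Hypothesis c_gt0 : 0 < c.
Hypothesis vi : variational_inequality P qd ud varrho c kappa.
Hypothesis dF_gt0 : 0 < dFnorm P qd ud.
Hypothesis kappa_index : index_function D kappa.

Let misfit q u : R :=
  `|opC P u - opC P ud| ^+ 2 + varrho * `|opA P q u - opA P qd ud|.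
Let source q u : R := hdot (qd - q0 P) (q - qd) + hdot (ud - u0 P) (u - ud).
Let err q u : R := sqnorm (q - qd) (u - ud).
Let dF (q : Q) (u : V) : dual W := dAq P qd ud q + dAu P qd ud u.

Let in_ballE q u : in_ball P rho q u <-> sqnorm (q - q0 P) (u - u0 P) <= rho ^+ 2.
Proof.
rewrite /in_ball -(@ler_pXn2r _ 2) ?nnegrE ?sqrtr_ge0 ?(ltW rho_gt0)//.
by rewrite sqr_sqrtr ?sqnorm_ge0.
Qed.

Let M_gt0 : 0 < M. Proof. by rewrite exprn_gt0. Qed.

Let misfit_ge0 q u : 0 <= misfit q u.
Proof. by rewrite addr_ge0 ?mulr_ge0 ?sqr_ge0 ?(ltW varrho_gt0). Qed.

(** As [(qd, ud)] may lie on the boundary of the ball, a direction is realized, after scaling, as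
    the difference of a ball point and the centre. If the derivative vanished on all ball points
    minus [(qd, ud)], it would vanish on every direction. *)
Lemma exists_nonkernel_in_ball : exists q u, in_ball P rho q u /\
  (dC P ud (u - ud) != 0 \/ dF (q - qd) (u - ud) != 0).
Proof.
apply: contrapT => noF.
have F0 q u : in_ball P rho q u -> dC P ud (u - ud) = 0 /\ dF (q - qd) (u - ud) = 0.
  move=> ball; apply: contrapT => /not_andP F; apply: noF; exists q, u; split => //.
  by case: F => /eqP; [left|right].
have F00 d : dC P ud d.2 = 0 /\ dF d.1 d.2 = 0.
  pose n := Num.sqrt (sqnorm d.1 d.2); pose s := rho / (n + 1).
  have n0 : 0 <= n by exact: sqrtr_ge0.
  have s0 : 0 < s by rewrite divr_gt0// ltr_wpDl.
  have sn : s * n <= rho.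
    by rewrite /s mulrAC ler_pdivrMr ?ltr_wpDl// ler_wpM2l ?(ltW rho_gt0)// lerDl.
  clearbody s.
  have ball0 : in_ball P rho (q0 P) (u0 P).
    by apply/in_ballE; rewrite !subrr /sqnorm !normr0 expr0n/= addr0 sqr_ge0.
  have ball1 : in_ball P rho (s *: d.1 + q0 P) (s *: d.2 + u0 P).
    apply/in_ballE; rewrite !addrK /sqnorm !normrZ !exprMn -mulrDr.
    rewrite real_normK ?num_real//.
    rewrite -/(sqnorm d.1 d.2) -[sqnorm _ _]sqr_sqrtr ?sqnorm_ge0// -/n.
    rewrite -exprMn ler_pXn2r ?nnegrE ?mulr_ge0 ?(ltW s0) ?(ltW rho_gt0)//.
  have [C0 A0] := F0 _ _ ball0; have [C1 A1] := F0 _ _ ball1.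
  have sI (H : lmodType R) (x : H) : s *: x = 0 -> x = 0.
    by move/eqP; rewrite scaler_eq0 gt_eqF//= => /eqP.
  split; apply: sI.
    by move: C1; rewrite -addrA linearP/= C0 addr0.
  move: A1; rewrite /dF -!(addrA (s *: _)) !linearP/= addrACA -scalerDr.
  by rewrite -/(dF (q0 P - qd) (u0 P - ud)) A0 addr0.
suff : dFnorm P qd ud <= 0 by rewrite leNgt dF_gt0.
apply: ge_sup.
  exists (Num.sqrt (sqnorm (dC P ud 0) (dAq P qd ud 0 + dAu P qd ud 0))).
  exists (0, 0) => //=.
  by rewrite /sqnorm !normr0 expr0n/= addr0 sqrtr0.
move=> _ [d _ <-]; have [-> A0] := F00 d.
by rewrite -/(dF d.1 d.2) A0 /sqnorm !normr0 expr0n/= addr0 sqrtr0.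
Qed.

(** A positive misfit puts the argument of [kappa] into []0, mu]], where [kappa] is monotone. *)
Lemma source_le_pos q u mu : in_ball P rho q u -> D mu ->
  0 < misfit q u < mu * err q u ->
  `|source q u| <= c * Num.sqrt (err q u) * kappa mu.
Proof.
move=> ball Dmu /andP[N0 Nmu].
have /andP[mu0 muM] : 0 < mu <= M by move: Dmu; rewrite /= in_itv.
have e0 : 0 < err q u by rewrite -(@pmulr_rgt0 _ mu)// (lt_trans N0).
case: sol => _ /(_ q u ball)[dA dC'] _ _.
apply: le_trans (vi dA dC') _.
rewrite ler_wpM2l ?mulr_ge0 ?sqrtr_ge0 ?(ltW c_gt0)//.
have NE : misfit q u / err q u <= mu by rewrite ler_pdivrMr// ltW.
apply: (index_function_le kappa_index _ Dmu NE).
by rewrite /= in_itv/= divr_gt0//= (le_trans NE).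
Qed.

(** The cone condition at the exact solution bounds residuals by linearized ones, which scale
    linearly along a segment. *)
Lemma misfit_le q u : in_ball P rho q u ->
  misfit q u <= (`|dC P ud (u - ud)| / (1 - ctc)) ^+ 2
    + varrho * (`|dF (q - qd) (u - ud)| / (1 - 4 * ctc ^+ 2)).
Proof.
case: sol => balld _ _ _ /(tcone balld)[tcC tcA].
have ctc_lt1 : ctc < 1 by rewrite (le_lt_trans ctc_le4V)// invf_lt1 ?ltr1n.
have CE : `|opC P u - opC P ud| <= `|dC P ud (u - ud)| / (1 - ctc).
  rewrite distrC -(normrN (dC _ _ _)) -linearN opprB.
  exact: normr_le_tcone.
have AE : `|opA P q u - opA P qd ud|
    <= `|dF (q - qd) (u - ud)| / (1 - 4 * ctc ^+ 2).
  rewrite distrC -(normrN (dF _ _)) /dF opprD -!linearN !opprB.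
  apply: normr_le_tcone; first by rewrite -subr_gt0 inverse_gap_gt0.
  by move: tcA; rewrite -addrA -opprD.
rewrite /misfit lerD ?ler_wpM2l ?(ltW varrho_gt0)//.
by rewrite ler_pXn2r ?nnegrE ?(le_trans _ CE).
Qed.

Lemma misfit_eq0 q u : in_ball P rho q u -> misfit q u = 0 ->
  dC P ud (u - ud) = 0 /\ dF (q - qd) (u - ud) = 0.
Proof.
move=> ball /eqP; rewrite paddr_eq0 ?mulr_ge0 ?sqr_ge0 ?(ltW varrho_gt0)//.
rewrite expf_eq0 mulf_eq0 (gt_eqF varrho_gt0) !normr_eq0 /= !subr_eq0.
move=> /andP[/eqP Cu /eqP Au]; case: sol => balld _ _ _.
have [] := tcone balld ball; rewrite Cu Au !subrr !normr0 !mulr0 !sub0r.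
rewrite !normrN -opprD normrN !normr_le0 => /eqP C0 /eqP A0; split.
  by apply/eqP; rewrite -oppr_eq0 -linearN opprB/= C0.
by apply/eqP; rewrite -oppr_eq0 /dF opprD -!linearN !opprB/= A0.
Qed.

(* kappa is unconstrained at 0, so the value of the inequality at a further
   solution is recovered as a limit of values at points with positive misfit,
   which exist because F'(qd, ud) does not vanish. *)
Lemma source_le_zero q u mu : in_ball P rho q u -> D mu ->
  misfit q u = 0 -> 0 < err q u ->
  `|source q u| <= c * Num.sqrt (err q u) * kappa mu.
Proof.
move=> ball Dmu N0 e0; have [C0 A0] := misfit_eq0 ball N0.
have /andP[mu0 muM] : 0 < mu <= M by move: Dmu; rewrite /= in_itv.
have [wq [wu [ballw Fw]]] := exists_nonkernel_in_ball.
(* The segment from the further solution to a point outside the kernel: since the derivative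
   vanishes on [(q - qd, u - ud)], its value along the segment is [t] times a fixed nonzero one. *)
pose qt t := q + t *: (wq - q); pose ut t := u + t *: (wu - u).
have qtE t : qt t - qd = t *: (wq - q) + (q - qd) by rewrite /qt addrAC addrC.
have utE t : ut t - ud = t *: (wu - u) + (u - ud) by rewrite /ut addrAC addrC.
have Ct t : dC P ud (ut t - ud) = t *: dC P ud (wu - ud).
  rewrite utE linearP/= C0 addr0; congr (_ *: _).
  by rewrite -[wu - u](subrKA ud) -(opprB u) linearB/= C0 subr0.
have At t : dF (qt t - qd) (ut t - ud) = t *: dF (wq - qd) (wu - ud).
  rewrite /dF qtE utE !linearP/= addrACA.
  rewrite -/(dF (q - qd) (u - ud)) A0 addr0 -scalerDr.
  congr (_ *: _); rewrite -[wu - u](subrKA ud) -[wq - q](subrKA qd).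
  rewrite -(opprB u) -(opprB q) (linearB (dAq P qd ud)) (linearB (dAu P qd ud)).
  rewrite /= addrACA -opprD.
  by rewrite -/(dF (q - qd) (u - ud)) A0 subr0.
have ballt t : 0 <= t <= 1 -> in_ball P rho (qt t) (ut t).
  move=> t01; apply/in_ballE; rewrite /qt /ut !(addrAC _ (_ *: _)).
  apply: le_trans (sqnorm_convex _ _ _ _ t01) _.
  rewrite (addrC (q - q0 P)) (addrC (u - u0 P)) !subrKA.
  move: ball ballw t01 => /in_ballE b0 /in_ballE b1 /andP[t0 t1].
  rewrite [leRHS](_ : _ = (1 - t) * rho ^+ 2 + t * rho ^+ 2); last by ring.
  by rewrite lerD// ler_wpM2l// subr_ge0.
pose K := (`|dC P ud (wu - ud)| / (1 - ctc)) ^+ 2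
    + varrho * (`|dF (wq - qd) (wu - ud)| / (1 - 4 * ctc ^+ 2)).
have Nt t : 0 < t <= 1 -> 0 < misfit (qt t) (ut t) <= t * K.
  move=> /andP[t0 t1]; have bt : in_ball P rho (qt t) (ut t) by rewrite ballt// ltW.
  apply/andP; split.
    rewrite lt_neqAle misfit_ge0 andbT eq_sym; apply/eqP => /(misfit_eq0 bt).
    rewrite Ct At => -[/eqP + /eqP]; rewrite !scaler_eq0 gt_eqF//=.
    by case: Fw => /negPf ->.
  apply: le_trans (misfit_le bt) _; rewrite Ct At !normrZ gtr0_norm// /K mulrDr.
  rewrite -!mulrA (mulrCA varrho) lerD2r exprMn ler_wpM2r ?sqr_ge0//.
  by rewrite expr2 ler_piMr ?(ltW t0).
pose ea := 2 * hdot (q - qd) (wq - q) + 2 * hdot (u - ud) (wu - u).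
pose eb := `|wq - q| ^+ 2 + `|wu - u| ^+ 2.
have et t : err (qt t) (ut t) = err q u + t * ea + t ^+ 2 * eb.
  rewrite /err /sqnorm qtE utE !(addrC (t *: _)) !sqr_normDZ /ea /eb.
  ring.
pose sa := hdot (qd - q0 P) (wq - q) + hdot (ud - u0 P) (wu - u).
have st t : source (qt t) (ut t) = source q u + t * sa + t ^+ 2 * 0.
  by rewrite /source qtE utE !hdotDr !hdotZr /sa; ring.
have lim_e : err (qt t) (ut t) @[t --> 0^'+] --> err q u.
  by under eq_fun do rewrite et; exact: quadratic_cvg_at_right0.
have lim_s : source (qt t) (ut t) @[t --> 0^'+] --> source q u.
  by under eq_fun do rewrite st; exact: quadratic_cvg_at_right0.
have lhs : `|source (qt t) (ut t)| @[t --> 0^'+] --> `|source q u|.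
  exact: cvg_norm.
have rhs : (c * Num.sqrt (err (qt t) (ut t)) * kappa mu) @[t --> 0^'+]
    --> c * Num.sqrt (err q u) * kappa mu.
  apply: cvgM; last exact: cvg_cst.
  apply: cvgM; first exact: cvg_cst.
  by apply: continuous_cvg => //; exact: sqrt_continuous.
apply: (ler_cvg_to lhs rhs).
(* The misfit is at most [t * K] while the error keeps a positive limit, so for small [t] the points
   on the segment meet the assumptions of [source_le_pos]. *)
have gap : (mu * err (qt t) (ut t) - t * K) @[t --> 0^'+] --> mu * err q u - 0.
  apply: cvgB; first by apply: cvgM => //; exact: cvg_cst.
  have := @quadratic_cvg_at_right0 R 0 K 0.
  by under eq_fun do rewrite mulr0 addr0 add0r.
have gap0 : 0 < mu * err q u - 0 by rewrite subr0 mulr_gt0.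
near=> t.
have t01 : 0 < t <= 1.
  by apply/andP; split; near: t; [exact: nbhs_right_gt|exact: nbhs_right_le].
have /andP[Npos Nle] := Nt t t01.
apply: source_le_pos => //; first by apply: ballt; case/andP: t01 => /ltW -> ->.
rewrite Npos (le_lt_trans Nle)// -subr_gt0.
by near: t; apply: (cvgr_gt _ gap).
Unshelve. all: by end_near. Qed.

Lemma source_le q u mu : in_ball P rho q u -> D mu ->
  misfit q u < mu * err q u ->
  `|source q u| <= c * Num.sqrt (err q u) * kappa mu.
Proof.
move=> ball Dmu Nmu.
have /andP[mu0 muM] : 0 < mu <= M by move: Dmu; rewrite /= in_itv.
have [N0|N0] := eqVneq (misfit q u) 0.
  by apply: source_le_zero; rewrite // -(@pmulr_rgt0 _ mu)// -N0.
by apply: source_le_pos; rewrite // Nmu lt_neqAle eq_sym N0 misfit_ge0.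
Qed.

Lemma err_le_rate q u (b d mu : R) : in_ball P rho q u ->
  sqnorm (q - q0 P) (u - u0 P) <= sqnorm (qd - q0 P) (ud - u0 P) ->
  0 < b -> 0 < d -> misfit q u <= (b * d) ^+ 2 ->
  D mu -> psi kappa mu = b / (2 * c) * d ->
  err q u <= b ^+ 2 * (d ^+ 2 / mu).
Proof.
move=> ball le_d b0 d0 Nle Dmu psimu.
have /andP[mu0 muM] : 0 < mu <= M by move: Dmu; rewrite /= in_itv.
rewrite mulrA -exprMn ler_pdivlMr// mulrC leNgt; apply/negP => lt.
have := source_le ball Dmu (le_lt_trans Nle lt).
have : err q u <= 2 * `|source q u|.
  (* Expanding the square of [(q - qd) + (qd - q0 P)], and likewise for [u], in the assumption that
     the iterate is no farther from the initial guess than the solution. *)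
  have : err q u + 2 * source q u <= 0.
    move: le_d; rewrite -(subrKA qd q) -(subrKA ud u) /sqnorm (sqr_normD (q - _))
      (sqr_normD (u - _)).
    rewrite /err /source /sqnorm (hdotC (qd - _)) (hdotC (ud - _)).
    move: (hdot (q - qd) _) (hdot (u - ud) _) (`|q - qd| ^+ 2) (`|u - ud| ^+ 2).
    move: (`|qd - _| ^+ 2) (`|ud - _| ^+ 2) => *; lra.
  have := ler_norm (- source q u); rewrite normrN.
  move: (err q u) (source q u) `|source q u| => *; lra.
rewrite -{1}[err q u]sqr_sqrtr ?sqnorm_ge0//.
have e0 : 0 < Num.sqrt (err q u).
  by rewrite sqrtr_gt0 -(@pmulr_rgt0 _ mu)// (le_lt_trans _ lt)// sqr_ge0.
have sq : b * d < Num.sqrt mu * Num.sqrt (err q u).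
  rewrite -(@ltr_pXn2r _ 2) ?nnegrE ?mulr_ge0 ?sqrtr_ge0 ?ltW//.
  by rewrite [ltRHS]exprMn !sqr_sqrtr ?sqnorm_ge0 ?(ltW mu0).
move: e0 sq; set e := Num.sqrt (err q u); set s := `|source q u|.
move=> e0 sq es sc.
have ek : e <= 2 * c * kappa mu.
  rewrite -(ler_pM2l e0) -expr2 (le_trans es)// (le_trans (ler_wpM2l _ sc))//.
  by rewrite le_eqVlt; apply/orP; left; apply/eqP; ring.
have := lt_le_trans sq (ler_wpM2l (sqrtr_ge0 mu) ek).
rewrite ltNge => /negP; apply.
rewrite [leLHS](_ : _ = 2 * c * psi kappa mu); last by rewrite /psi; ring.
by rewrite psimu [leLHS](_ : _ = b * d)//; field; rewrite gt_eqF.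
Qed.

End VariationalInequality.

(** * Choice of the constants and the rate *)

Lemma cone_constant_small (R : realFieldType) (tau c1 ctc : R) :
  0 < tau -> 0 < c1 -> 0 < ctc ->
  ctc <= (4 * (1 + tau ^+ 2) * (1 + `|c1|))^-1 ->
  ctc <= 4^-1 /\ 4 * ctc * (1 + c1) <= (tau ^+ 2)^-1.
Proof.
move=> tau0 c10 ctc0; rewrite gtr0_norm//.
have t2 : 0 < tau ^+ 2 by rewrite exprn_gt0.
have d0 : 0 < (1 + tau ^+ 2) * (1 + c1) by rewrite mulr_gt0// addr_gt0.
rewrite -[leRHS]mul1r ler_pdivlMr ?mulr_gt0 ?addr_gt0// => le.
have one_le : 1 <= (1 + tau ^+ 2) * (1 + c1) by rewrite mulr_ege1// lerDl ltW.
split; rewrite -[leRHS]mul1r ler_pdivlMr//; apply: le_trans le.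
  by rewrite -mulrA ler_pM2l// ler_peMr.
rewrite [leRHS](_ : _ = 4 * ctc * (1 + c1) * (1 + tau ^+ 2)); last by ring.
by rewrite ler_wpM2l ?lerDr// !mulr_ge0// ltW// addr_gt0.
Qed.

Lemma misfit_le_data (R : realType) (Q V G W : hilbertType R)
    (P : problem Q V G W) (gd : G) (varrho delta : R) q u (ud : V) (qd : Q) :
  opC P ud = obs P -> opA P qd ud = rhs P -> `|obs P - gd| <= delta -> 0 < varrho ->
  `|opC P u - opC P ud| ^+ 2 + varrho * `|opA P q u - opA P qd ud|
    <= 2 * I34 P gd varrho setT q u + 2 * delta ^+ 2.
Proof.
move=> -> -> noise varrho0.
have delta0 : 0 <= delta by exact: le_trans noise.
have le : `|opC P u - obs P| <= `|opC P u - gd| + delta.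
  by rewrite (le_trans (ler_distD gd _ _))// lerD2l distrC.
rewrite /I34 mulrDr addrAC lerD ?(sqr_le_sumD _ le)//.
by rewrite ler_peMl ?ler1n// mulr_ge0// ltW.
Qed.

Theorem theorem4 (R : realType) (tau theta_lo theta_hi c1 c2 c3 : R) :
  exists2 ctc0 : R, 0 < ctc0 &
  forall (Q V G W : hilbertType R) (P : problem Q V G W)
    (rho ctc varrho cadj c : R) (qd : Q) (ud : V) (kappa : R -> R)
    (gdelta : R -> G) (X : R -> gn_run Q V W),
  let D : set R := `]0, dFnorm P qd ud ^+ 2]%classic in
  0 < tau -> 0 < c1 -> 0 < c2 -> 0 < c3 ->
  0 < rho -> 0 < ctc < 1 -> ctc <= ctc0 ->
  has_derivatives P rho ->
  is_solution_in_ball P rho qd ud ->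
  pde_solvable P rho ->
  weakly_seq_closed P ->
  tangential_cone P rho ctc ->
  parameter_choice ctc tau theta_lo theta_hi ->
  bounded_on_ball P rho ->
  0 < varrho ->
  cadj * (`|qd - q0 P| + `|ud - u0 P| + 1) <= varrho ->
  (forall delta : R, 0 < delta ->
    [/\ `|obs P - gdelta delta| <= delta,
        gn_iteration P (gdelta delta) (X delta),
        adjoint_bound P (gdelta delta) (X delta) rho cadj,
        discretization_accuracy P (gdelta delta) (X delta)
          varrho ctc tau theta_lo theta_hi c1 c2 c3 &
        beta_choice P (gdelta delta) (X delta) varrho theta_lo theta_hi]) ->
  0 < c ->
  variational_inequality P qd ud varrho c kappa ->
  0 < dFnorm P qd ud ->
  index_function D kappa ->
  exists deltabar Cbar K : R,
    [/\ 0 < deltabar, 0 < Cbar, 0 < K &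
      forall delta : R, 0 < delta <= deltabar ->
        exists kstar : nat,
          [/\ is_stopping_index P (gdelta delta) (X delta)
                varrho tau delta kstar,
              (psi kappa @` D) (Cbar * delta) &
              sqnorm (qold (X delta) kstar - qd) (uold (X delta) kstar - ud)
                <= K * (delta ^+ 2 / inv_on D (psi kappa) (Cbar * delta))]].
Proof.
(* The absolute value makes this threshold positive before the sign of [c1] is assumed. *)
exists (4 * (1 + tau ^+ 2) * (1 + `|c1|))^-1.
  by rewrite invr_gt0 !mulr_gt0// ltr_pwDl// ?sqr_ge0.
move=> Q V G W P rho ctc varrho cadj c qd ud kappa gdelta X D tau0 c10 _ c30.
move=> rho0 /andP[ctc0 _] /(cone_constant_small tau0 c10 ctc0)[ctc4 slack].
move=> _ sol _ _ tcone _ _ varrho0 cadj_le run c0 vi dF0 kidx.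
have M0 : 0 < dFnorm P qd ud ^+ 2 by rewrite exprn_gt0.
(* The misfit of the stopped iterate with respect to exact data will be at most [B * delta ^+ 2]. *)
pose B := 2 * ((1 + c1) * tau ^+ 2 + 1).
have B0 : 0 < B.
  by rewrite mulr_gt0// ltr_wpDl// mulr_ge0 ?sqr_ge0// ltW// addr_gt0.
have b0 : 0 < Num.sqrt B by rewrite sqrtr_gt0.
have C0 : 0 < Num.sqrt B / (2 * c) by rewrite divr_gt0// mulr_gt0.
have psiM : 0 < psi kappa (dFnorm P qd ud ^+ 2).
  by apply: (psi_gt0 kidx); rewrite /= in_itv/= M0 lexx.
(* [err_le_rate] is applied with [b := Num.sqrt B], which fixes the last two constants; the first
   one keeps [Cbar * delta] in the range of [psi]. *)
exists (psi kappa (dFnorm P qd ud ^+ 2) / (Num.sqrt B / (2 * c))),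
  (Num.sqrt B / (2 * c)), B.
split=> // [|delta /andP[delta0]]; first exact: divr_gt0.
rewrite ler_pdivlMr// mulrC => deltaM.
have [noise iter adj acc beta_ok] := run delta delta0.
have c21 : c2 < 1 by case: acc => _ _ _ _ [].
have [k stop] := exists_stopping_index tau0 c30 ctc0 ctc4 slack sol tcone varrho0
  cadj_le delta0 noise iter adj acc beta_ok c21.
exists k; case: (stop) => k0 I3k_le I3_gt.
have le_d := qold_uold_in_ball tau0 ctc0 slack sol tcone
  cadj_le delta0 noise iter adj acc beta_ok k0 I3_gt.
have ypsi : 0 < Num.sqrt B / (2 * c) * delta <= psi kappa (dFnorm P qd ud ^+ 2).
  by rewrite deltaM mulr_gt0.
have [Dmu psimu] := inv_on_psi M0 kidx ypsi.
split => //; first exact: (psi_surj M0 kidx ypsi).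
rewrite -{1}[B]sqr_sqrtr ?(ltW B0)//.
apply: (err_le_rate rho0 ctc0 ctc4 sol tcone varrho0 c0 vi dF0 kidx) => //.
  exact: sqnorm_in_ball sol _ _ le_d.
case: sol => _ _ C_d A_d.
apply: le_trans (misfit_le_data _ _ C_d A_d noise varrho0) _.
rewrite exprMn sqr_sqrtr ?(ltW B0)//.
case: acc => /(_ k k0)[_ _ I3e _] /(_ k k0)[_ e3e] _ _ _.
(* The stopping rule controls the discrete I_3; the bound [eta3 <= c1 * I_3h] carries it over to the
   norm of the full dual space. *)
have I3_le : I3k P (gdelta delta) (X delta) varrho k
    <= (1 + c1) * (tau ^+ 2 * delta ^+ 2).
  apply: (@le_trans _ _ ((1 + c1) * I3hk P (gdelta delta) (X delta) varrho k)).
    move: I3e; rewrite distrC => /ler_normlW; rewrite lerBlDl => /le_trans; apply.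
    by rewrite mulrDl mul1r lerD2l.
  by rewrite ler_wpM2l// ltW// addr_gt0.
rewrite [leRHS](_ : _ = 2 * ((1 + c1) * (tau ^+ 2 * delta ^+ 2)) + 2 * delta ^+ 2);
  last by rewrite /B; ring.
by rewrite lerD2r ler_pM2l.
Qed.
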